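(* All special identities of Gelfand--Dorfman algebras of degree $\le 5$ are consequences (modulo the defining identities of Gelfand--Dorfman algebras) of the following two identities of degree 4: $$[c,a\circ d]\circ b + ([a,c]\circ d)\circ b = [c,(a\circ b)\circ d] - [c,a\circ b]\circ d$$ and $$2([a,b]\circ c)\circ d = [b\circ c, a\circ d] - [a\circ c, b\circ d] + ([a,b\circ c] -[b,a\circ c])\circ d + ([a,b\circ d] - [b,a\circ d])\circ c.$$ That is, every identity of degree at most $5$ that holds on all special Gelfand--Dorfman algebras holds on every Gelfand--Dorfman algebra satisfying these two identities.
   Context: All algebras are over a field $\Bbbk$. A Gelfand--Dorfman algebra (GD-algebra) is a linear space $V$ with two bilinear operations $\circ$ and $[\cdot,\cdot]$ such that: (i) $(V,\circ)$ is a Novikov algebra, i.e. $(a\circ b)\circ c-a\circ(b\circ c)=(b\circ a)\circ c-b\circ(a\circ c)$ and $(a\circ b)\circ c=(a\circ c)\circ b$ for all $a,b,c\in V$; (ii) $(V,[\cdot,\cdot])$ is a Lie algebra; (iii) $b\circ[a,c]=[a,b\circ c]-[c,b\circ a]+[b,a]\circ c-[b,c]\circ a$ for all $a,b,c\in V$. A differential Poisson algebra is a Poisson algebra $(P,\cdot,\{\cdot,\cdot\})$ ($(P,\cdot)$ is associative and commutative, $(P,\{\cdot,\cdot\})$ is a Lie algebra, and $\{x,yz\}=y\{x,z\}+z\{x,y\}$) with a linear map $d:P\to P$ that is a derivation with respect to both operations: $d(xy)=x\,d(y)+d(x)\,y$ and $d\{x,y\}=\{d(x),y\}+\{x,d(y)\}$.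 Given such $P$, the space $P$ with operations $x\circ y=x\,d(y)$, $[x,y]=\{x,y\}$ is a GD-algebra, denoted $P^{(d)}$. A GD-algebra $V$ is special if there exist a differential Poisson algebra $P$ with derivation $d$ and an injective homomorphism of GD-algebras $V\to P^{(d)}$. A special identity is an identity in the operations $\circ$ and $[\cdot,\cdot]$ that holds on all special GD-algebras but does not hold on all GD-algebras. Equivalently, the special identities are the (nonzero) elements of the free GD-algebra on a countable set $X$ that lie in the kernel of the natural homomorphism to its universal differential Poisson envelope. The degree of an identity is its degree in the variables.
   Formalization: The field is assumed to have characteristic different from 2; over every field of characteristic 2 the claim fails, since ([a,b]∘c)∘c = [b∘c,a∘c] + ([a,b∘c] − [b,a∘c])∘c is special but does not follow from the two identities. *)

(* Defs.v *)
From HB Require Import structures.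
From mathcomp Require Import all_boot all_order all_algebra.
From mathcomp Require Import finmap.
From mathcomp Require Import monalg.

Set Implicit Arguments.
Unset Strict Implicit.
Unset Printing Implicit Defensive.

Import GRing.Theory.
Local Open Scope ring_scope.

Definition bilinear_op (k : fieldType) (V : lmodType k) (m : V -> V -> V) :=
  bilinear_for *:%R *:%R m.

(* Alternating, not merely antisymmetric: the two differ in characteristic 2. *)
Definition lie_op (k : fieldType) (V : lmodType k) (br : V -> V -> V) :=
  [/\ bilinear_op br,
      forall a, br a a = 0 &
      forall a b c, br a (br b c) + br b (br c a) + br c (br a b) = 0].

Definition novikov_op (k : fieldType) (V : lmodType k) (m : V -> V -> V) :=
  [/\ bilinear_op m,
      forall a b c, m (m a b) c - m a (m b c) = m (m b a) c - m b (m a c) &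
      forall a b c, m (m a b) c = m (m a c) b].

HB.mixin Record Lmodule_isGDAlgebra (k : fieldType) V of GRing.Lmodule k V := {
  circ : V -> V -> V;
  brk : V -> V -> V;
  circ_novikov : novikov_op circ;
  brk_lie : lie_op brk;
  circ_brk : forall a b c : V,
    circ b (brk a c) =
      brk a (circ b c) - brk c (circ b a) + circ (brk b a) c - circ (brk b c) a
}.

#[short(type="gdAlgType")]
HB.structure Definition GDAlgebra (k : fieldType) :=
  {V of GRing.Lmodule k V & Lmodule_isGDAlgebra k V}.

Declare Scope gd_scope.
Delimit Scope gd_scope with GD.
Notation "a \circ b" := (circ a b)
  (at level 40, left associativity) : gd_scope.
Notation "{< a , b >}" := (brk a b)
  (at level 0, a, b at level 99, format "{<  a ,  b  >}") : gd_scope.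

(* The commutative associative product of a Poisson algebra is not required to
   have a unit, hence it is not taken from the ring hierarchy. *)
HB.mixin Record Lmodule_isDiffPoisson (k : fieldType) P of GRing.Lmodule k P := {
  pmul : P -> P -> P;
  pbrk : P -> P -> P;
  pder : P -> P;
  pmul_bilinear : bilinear_op pmul;
  pmulA : associative pmul;
  pmulC : commutative pmul;
  pbrk_lie : lie_op pbrk;
  pbrk_leibniz : forall x y z : P,
    pbrk x (pmul y z) = pmul y (pbrk x z) + pmul z (pbrk x y);
  pder_linear : linear pder;
  pder_mul : forall x y : P,
    pder (pmul x y) = pmul x (pder y) + pmul (pder x) y;
  pder_brk : forall x y : P,
    pder (pbrk x y) = pbrk (pder x) y + pbrk x (pder y)
}.

#[short(type="diffPoissonType")]
HB.structure Definition DiffPoisson (k : fieldType) :=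
  {P of GRing.Lmodule k P & Lmodule_isDiffPoisson k P}.

(* The Gelfand--Dorfman algebra [P^(d)], on an alias of the carrier of [P]. *)
Definition derivedGD (k : fieldType) (P : diffPoissonType k) : Type := P.

Section DerivedGD.
Variables (k : fieldType) (P : diffPoissonType k).

HB.instance Definition _ := GRing.Lmodule.on (derivedGD P).

Definition derived_circ (x y : derivedGD P) : derivedGD P :=
  pmul (x : P) (pder (y : P)).
Definition derived_brk (x y : derivedGD P) : derivedGD P :=
  pbrk (x : P) (y : P).

Lemma pmulDr (x y z : P) : pmul x (y + z) = pmul x y + pmul x z.
Proof. by have := (pmul_bilinear (s := P)).2 x 1 y z; rewrite /= !scale1r. Qed.

Lemma pbrkN (x y : P) : pbrk x y = - pbrk y x.
Proof.
have [[bl br] alt _] := pbrk_lie (s := P).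
have /= addl (u v w : P) : pbrk (u + v) w = pbrk u w + pbrk v w.
  by have := bl w 1 u v; rewrite /= !scale1r.
have /= addr (u v w : P) : pbrk u (v + w) = pbrk u v + pbrk u w.
  by have := br u 1 v w; rewrite /= !scale1r.
apply/eqP; rewrite -addr_eq0; apply/eqP.
by have := alt (x + y); rewrite addl !addr !alt add0r addr0.
Qed.

Fact derived_novikov : novikov_op derived_circ.
Proof.
have [bl br] := pmul_bilinear (s := P).
have cancel (u v : P) : u - (v + u) = - v by rewrite opprD addrCA addrN addr0.
rewrite /derived_circ; split.
- split=> [z | x] c u v /=; first exact: bl.
  by rewrite pder_linear; exact: br.
- move=> a b c; rewrite !pder_mul !pmulDr -!pmulA !cancel.
  by rewrite !pmulA (pmulC a).
- by move=> a b c; rewrite -!pmulA (pmulC (pder b)).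
Qed.

Fact derived_circ_brk (a b c : derivedGD P) :
  derived_circ b (derived_brk a c) =
    derived_brk a (derived_circ b c) - derived_brk c (derived_circ b a)
    + derived_circ (derived_brk b a) c - derived_circ (derived_brk b c) a.
Proof.
rewrite /derived_circ /derived_brk pder_brk pmulDr !pbrk_leibniz.
have pmulNl (x y : P) : pmul (- x) y = - pmul x y.
  have p0 : pmul y 0 = 0 by apply: (addrI (pmul y 0)); rewrite -pmulDr !addr0.
  apply/eqP; rewrite -addr_eq0; apply/eqP.
  by rewrite !(pmulC _ y) -pmulDr addNr p0.
rewrite (pbrkN b a) (pbrkN b c) !pmulNl opprK (pbrkN (pder a) c).
rewrite !(pmulC (pbrk _ _)) -[pmul b (- _)]pmulC pmulNl (pmulC _ b).
rewrite opprD !addrA.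
set A := pmul b _; set B := pmul b _; set C := pmul _ _; set D := pmul _ _.
by rewrite (addrAC B) (addrAC _ C) addrK subrK addrC.
Qed.

HB.instance Definition _ :=
  Lmodule_isGDAlgebra.Build k (derivedGD P)
    derived_novikov (pbrk_lie (s := P)) derived_circ_brk.

End DerivedGD.

Definition gd_morphism (k : fieldType) (V W : gdAlgType k) (f : V -> W) : Prop :=
  [/\ linear f,
      {morph f : a b / circ a b >-> circ a b} &
      {morph f : a b / brk a b >-> brk a b}].

Definition special (k : fieldType) (V : gdAlgType k) : Prop :=
  exists (P : diffPoissonType k) (f : V -> derivedGD P),
    gd_morphism f /\ injective f.

(* Nonassociative monomials: the free magma with two operations on the
   countable set of variables [x_0, x_1, ...]. *)
Inductive gdmonom : Type :=
| MVar of nat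
| MCirc of gdmonom & gdmonom
| MBrk of gdmonom & gdmonom.

Fixpoint gdmonom_encode (t : gdmonom) : GenTree.tree nat :=
  match t with
  | MVar i => GenTree.Leaf i
  | MCirc s t => GenTree.Node 0 [:: gdmonom_encode s; gdmonom_encode t]
  | MBrk s t => GenTree.Node 1 [:: gdmonom_encode s; gdmonom_encode t]
  end.

Fixpoint gdmonom_decode (t : GenTree.tree nat) : option gdmonom :=
  match t with
  | GenTree.Leaf i => Some (MVar i)
  | GenTree.Node 0 [:: s; t] =>
      if (gdmonom_decode s, gdmonom_decode t) is (Some s', Some t')
      then Some (MCirc s' t') else None
  | GenTree.Node 1 [:: s; t] =>
      if (gdmonom_decode s, gdmonom_decode t) is (Some s', Some t')
      then Some (MBrk s' t') else None
  | _ => None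
  end.

Fact gdmonom_encodeK : pcancel gdmonom_encode gdmonom_decode.
Proof. by elim=> //= s -> t ->. Qed.

HB.instance Definition _ := Countable.copy gdmonom (pcan_type gdmonom_encodeK).

Fixpoint mdegree (t : gdmonom) : nat :=
  match t with
  | MVar _ => 1
  | MCirc s t => mdegree s + mdegree t
  | MBrk s t => mdegree s + mdegree t
  end.

(* An identity is an element of [{malg k[gdmonom]}], the free algebra with two
   bilinear operations. Its degree is that of its largest monomial. *)
Definition gddegree (k : fieldType) (f : {malg k[gdmonom]}) : nat :=
  \max_(t <- msupp f) mdegree t.

Section Evaluation.
Variables (k : fieldType) (V : gdAlgType k) (x : nat -> V).

Fixpoint meval (t : gdmonom) : V :=
  match t with
  | MVar i => x i
  | MCirc s t => circ (meval s) (meval t)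
  | MBrk s t => brk (meval s) (meval t)
  end.

Definition gdeval (f : {malg k[gdmonom]}) : V :=
  \sum_(t <- msupp f) f@_t *: meval t.

End Evaluation.

Definition holds_on (k : fieldType) (V : gdAlgType k) (f : {malg k[gdmonom]}) :=
  forall x : nat -> V, gdeval x f = 0.

(* Main.v *)
Require Import Defs.
From HB Require Import structures.
From mathcomp Require Import all_boot all_order all_algebra.
From mathcomp Require Import finmap.
From mathcomp Require Import monalg ring zify.

(* In the free differential Poisson algebra, a product of r Lie words carrying
   r - 1 derivatives is a Gelfand--Dorfman polynomial in its letters; [phi] finds
   one by solving Leibniz rules. An identity of all special algebras vanishes in
   the differential Poisson algebra of polynomials in the associative words on
   the letters x_i^(j), whose bracket extends the commutator of words. So it
   suffices to map this algebra linearly to [V] in such a way that the value of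
   each monomial of degree at most 5 containing a circ goes to its value in [V].
   Such a map is built from [phi]. It is well defined because, in every algebra
   satisfying the two identities, the values of [phi] are symmetric in the Lie
   words and respect anticommutativity and the Jacobi identity. These are
   finitely many multilinear identities of degree at most 5; each is decided by
   normal forms modulo the instances of the axioms, which Gaussian elimination
   over Z[1/2] provides. Monomials without circ are treated separately, by
   evaluating the identity in [V] with zero product and derivation: for them the
   passage from associative words to Lie words would divide by 5. *)

Set Implicit Arguments.
Unset Strict Implicit.
Unset Printing Implicit Defensive.

Import GRing.Theory.
Local Open Scope ring_scope.

(** * Polynomial differential Poisson algebras *)

Section LinearExtension.
Variables (k : fieldType) (K : choiceType) (V : lmodType k).

Definition malg_lin (h : K -> V) (g : {malg k[K]}) : V :=
  \sum_(t <- msupp g) g@_t *: h t.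

Lemma malg_linEw (h : K -> V) (d : {fset K}) (g : {malg k[K]}) :
  (msupp g `<=` d)%fset -> malg_lin h g = \sum_(t <- d) g@_t *: h t.
Proof.
move=> le_gd; rewrite /malg_lin (big_fset_incl _ le_gd) // => t _ /mcoeff_outdom ->.
by rewrite scale0r.
Qed.

Lemma malg_lin_linear (h : K -> V) : linear (malg_lin h).
Proof.
move=> c f g; pose d := (msupp f `|` msupp g)%fset.
have sf : (msupp f `<=` d)%fset by apply: fsubsetUl.
have sg : (msupp g `<=` d)%fset by apply: fsubsetUr.
have sfg : (msupp (c *: f + g) `<=` d)%fset.
  apply: fsubset_trans (msuppD_le _ _) _; rewrite fsubUset sg andbT.
  exact: fsubset_trans (msuppZ_le _ _) sf.
rewrite (malg_linEw _ sf) (malg_linEw _ sg) (malg_linEw _ sfg) scaler_sumr -big_split.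
by apply: eq_bigr => t _; rewrite mcoeffD mcoeffZ scalerDl scalerA.
Qed.

Lemma malg_linU (h : K -> V) c t : malg_lin h << c *g t >> = c *: h t.
Proof. by rewrite (malg_linEw _ msuppU_le) big_seq_fset1 mcoeffUU. Qed.

Lemma malgUE (c : k) (t : K) : << c *g t >> = c *: << t >> :> {malg k[K]}.
Proof. by apply: (malgP _ _).1 => u; rewrite mcoeffZ !mcoeffU mulr_natr. Qed.
End LinearExtension.

(** The first letter of [s] moves to the front of [t] by adjacent transpositions, and [F (a :: _)]
    inherits the hypothesis. The symmetry of derivations and of functionals on monomials is thus
    checked on two neighbours. *)
Lemma adjacent_perm (A : eqType) (B : Type) (F : seq A -> B) :
    (forall s a b r, F (s ++ a :: b :: r) = F (s ++ b :: a :: r)) ->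
  forall s t, perm_eq s t -> F s = F t.
Proof.
move=> swF s; elim: s F swF => [|a s IH] F swF t.
  by rewrite perm_sym => /perm_nilP ->.
move=> st; have ta : a \in t by rewrite -(perm_mem st) mem_head.
case/splitPr: ta st => t1 t2 st.
have -> : F (t1 ++ a :: t2) = F (a :: t1 ++ t2).
  elim/last_ind: t1 t2 {st} => [|t1 b IHt] t2 //.
  by rewrite !cat_rcons -swF IHt.
apply: (IH (fun s => F (a :: s))) => [u b c v|]; first exact: (swF (a :: u)).
by rewrite -(perm_cons a) (perm_trans st) // perm_catC /= perm_cons perm_catC.
Qed.

Section CommutativeMonomials.
Variable (I : choiceType).

(** The order of the factors comes from [finsupp] and is arbitrary, hence the invariance under
    permutations asked of the maps extended by [poly_lin]. *)
Definition cmonom_seq (m : {cmonom I}) : seq I :=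
  flatten [seq nseq (m i) i | i <- finsupp m].
Definition seq_cmonom (s : seq I) : {cmonom I} := \big[mmul/mone]_(i <- s) ucm i.

Lemma count_cmonom_seq (m : {cmonom I}) i : count_mem i (cmonom_seq m) = m i.
Proof.
rewrite /cmonom_seq count_flatten -map_comp sumnE big_map.
have [im | /[dup] im] := boolP (i \in finsupp m).
  rewrite (big_fsetD1 i) //= count_nseq /= eqxx mul1n big_seq big1 ?addn0 // => j.
  by rewrite count_nseq in_fsetD1 => /andP[/negPf /= ->].
rewrite -cmE_eq0 => /eqP ->; rewrite big_seq big1 // => j jm /=.
by rewrite count_nseq /=; case: eqP im => // <-; rewrite jm.
Qed.

Lemma seq_cmonomE (s : seq I) i : seq_cmonom s i = count_mem i s.
Proof.
elim: s => [|j s IH]; first by rewrite /seq_cmonom big_nil cm1.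
by rewrite /seq_cmonom big_cons cmM cmU -/(seq_cmonom s) IH.
Qed.

Lemma perm_cmonom_seq (s : seq I) : perm_eq (cmonom_seq (seq_cmonom s)) s.
Proof. by apply/allP=> i _ /=; rewrite count_cmonom_seq seq_cmonomE. Qed.

Lemma cmonom_seqK : cancel cmonom_seq seq_cmonom.
Proof. by move=> m; apply/eqP/cmP => i; rewrite seq_cmonomE count_cmonom_seq. Qed.
End CommutativeMonomials.

Section PolynomialAlgebra.
Variables (k : fieldType) (I : choiceType).
Local Notation R := {malg k[{cmonom I}]}.

Definition gen (i : I) : R := << ucm i >>.

Lemma malgUM (m n : {cmonom I}) : << mmul m n >> = << m >> * << n >> :> R.
Proof. by rewrite malgM_def fgmulUU mulr1. Qed.

Lemma prod_gen (s : seq I) : \prod_(i <- s) gen i = << seq_cmonom s >> :> R.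
Proof.
elim: s => [|i s IH]; first by rewrite /seq_cmonom !big_nil.
by rewrite big_cons IH /seq_cmonom big_cons malgUM.
Qed.

Lemma poly_ind (P : R -> Prop) :
    P 0 -> (forall c p q, P p -> P q -> P (c *: p + q)) ->
    (forall s, P (\prod_(i <- s) gen i)) ->
  forall p, P p.
Proof.
move=> P0 PD Pgen p; rewrite (monalgE p); elim/big_rec: _ => // m q _ Pq.
rewrite malgUE; apply: PD => //.
by rewrite -(cmonom_seqK m) -prod_gen; apply: Pgen.
Qed.

Section Extension.
Variables (V : lmodType k) (h : seq I -> V).
Hypothesis h_perm : forall s t, perm_eq s t -> h s = h t.
Definition poly_lin : R -> V := malg_lin (h \o @cmonom_seq I).

Lemma poly_lin_linear : linear poly_lin. Proof. exact: malg_lin_linear. Qed.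

Lemma poly_lin_prod (s : seq I) : poly_lin (\prod_(i <- s) gen i) = h s.
Proof.
rewrite prod_gen /poly_lin malg_linU scale1r /=; apply: h_perm.
exact: perm_cmonom_seq.
Qed.
End Extension.

End PolynomialAlgebra.

Section LinearFacts.
Variables (k : fieldType) (U W : lmodType k) (F : U -> W).
Hypothesis linF : linear F.

Lemma lin0 : F 0 = 0.
Proof. by have := linF (-1) 0 0; rewrite !scaleN1r !addNr. Qed.
Lemma linD p q : F (p + q) = F p + F q.
Proof. by have := linF 1 p q; rewrite !scale1r. Qed.
Lemma linZ c p : F (c *: p) = c *: F p.
Proof. by have := linF c p 0; rewrite !addr0 lin0 addr0. Qed.
Lemma linN p : F (- p) = - F p.
Proof. by rewrite -scaleN1r linZ scaleN1r. Qed.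
Lemma linB p q : F (p - q) = F p - F q.
Proof. by rewrite linD linN. Qed.
Lemma lin_sum (J : Type) (r : seq J) (G : J -> U) :
  F (\sum_(j <- r) G j) = \sum_(j <- r) F (G j).
Proof. exact: (big_morph F linD lin0). Qed.
End LinearFacts.

(** * Derivations and biderivations of a polynomial algebra *)

Lemma leibniz_swap (A : comRingType) (a b x y u v : A) :
  a * (y * u) + x * (b * u + y * v) = b * (x * u) + y * (a * u + x * v).
Proof. by ring. Qed.

Lemma comm_leibniz (A : comRingType) (a b x y u v : A) :
  a + x + (y + u) - (b + y + (x + v)) = a - b + (u - v).
Proof. by ring. Qed.

(* [A] stands for [{malg k[{cmonom I}]}], through its induction principle and the
   linear extension of maps from monomials only. *)
Section Derivations.
Variables (k : fieldType) (I : eqType) (A : comAlgType k) (gen : I -> A).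
Local Notation mon s := (\prod_(i <- s) gen i).
Hypothesis mon_ind : forall P : A -> Prop,
    P 0 -> (forall c p q, P p -> P q -> P (c *: p + q)) ->
    (forall s, P (mon s)) -> forall p, P p.
Variable ext : (seq I -> A) -> A -> A.
Hypothesis ext_linear : forall h, linear (ext h).
Hypothesis ext_mon : forall h, (forall s t, perm_eq s t -> h s = h t) ->
  forall s, ext h (mon s) = h s.

Definition derivation (F : A -> A) : Prop :=
  linear F /\ forall p q, F (p * q) = p * F q + F p * q.

Lemma derivation1 F : derivation F -> F 1 = 0.
Proof.
case=> _ /(_ 1 1); rewrite !mul1r mulr1 => /(congr1 (fun x => x - F 1)).
by rewrite subrr addrK => ->.
Qed.

(** A derivation kills 1 and is determined on products by the Leibniz rule. Anticommutativity, the
    Jacobi identity and compatibility with the derivation are all reduced to generators in this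
    way. *)
Lemma derivation_ext F G :
  derivation F -> derivation G -> (forall i, F (gen i) = G (gen i)) -> F =1 G.
Proof.
move=> dF dG FG; have [[lF mF] [lG mG]] := (dF, dG).
elim/mon_ind=> [|c p q Fp Fq|s]; first by rewrite (lin0 lF) (lin0 lG).
  by rewrite lF lG Fp Fq.
elim: s => [|i s IH]; first by rewrite big_nil !derivation1.
by rewrite big_cons mF mG FG IH.
Qed.

Fixpoint der_seq (delta : I -> A) (s : seq I) : A :=
  if s is i :: s' then delta i * mon s' + gen i * der_seq delta s' else 0.

Lemma der_seq_cat delta s t :
  der_seq delta (s ++ t) = mon s * der_seq delta t + der_seq delta s * mon t.
Proof.
elim: s => [|i s IH] /=; first by rewrite big_nil mul1r mul0r addr0.
rewrite IH big_cat big_cons /=; set x := mon s; set y := mon t.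
by rewrite mulrDr mulrDl !mulrA addrCA.
Qed.

Definition der (delta : I -> A) : A -> A := ext (der_seq delta).

Lemma der_mon delta s : der delta (mon s) = der_seq delta s.
Proof.
apply: ext_mon; apply: adjacent_perm => {}s i j r.
by rewrite !der_seq_cat /= !big_cons [gen j * (gen i * _)]mulrCA leibniz_swap.
Qed.

Lemma der_gen delta i : der delta (gen i) = delta i.
Proof.
by have := der_mon delta [:: i]; rewrite big_seq1 /= big_nil mulr0 addr0 mulr1.
Qed.

Lemma mullin q : linear (fun p : A => p * q).
Proof. by move=> c x y; rewrite mulrDl scalerAl. Qed.

Lemma der_derivation delta : derivation (der delta).
Proof.
have lder : linear (der delta) := ext_linear _; split=> // p q; elim/mon_ind: p.
- by rewrite !mul0r (lin0 lder) mul0r addr0.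
- move=> c x y IHx IHy; rewrite mulrDl -scalerAl !lder IHx IHy.
  by rewrite !mulrDl -!scalerAl scalerDr addrACA.
move=> s; elim/mon_ind: q.
- by rewrite !mulr0 (lin0 lder) mulr0 addr0.
- move=> c x y IHx IHy; rewrite mulrDr -scalerAr !lder IHx IHy.
  by rewrite !mulrDr -!scalerAr scalerDr addrACA.
by move=> t; rewrite -big_cat !der_mon der_seq_cat.
Qed.

Lemma derivation_lin (c : k) F G : derivation F -> derivation G ->
  derivation (fun p => c *: F p + G p).
Proof.
move=> [lF mF] [lG mG]; split=> [a p q|p q].
  by rewrite lF lG !scalerDr !scalerA addrACA [c * a]mulrC.
rewrite mF mG !scalerDr mulrDr mulrDl scalerAr scalerAl.
by rewrite addrACA.
Qed.

Lemma derivation_sub F G : derivation F -> derivation G ->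
  derivation (fun p => F p - G p).
Proof.
move=> [lF mF] [lG mG]; split=> [a p q|p q].
  by rewrite lF lG scalerBr opprD addrACA.
by rewrite mF mG mulrBr mulrBl opprD addrACA.
Qed.

Lemma derivation0 : derivation (fun=> 0).
Proof. by split=> [c p q|p q]; rewrite ?scaler0 ?mulr0 ?mul0r addr0. Qed.

Lemma derivation_eq F G : F =1 G -> derivation F -> derivation G.
Proof. by move=> FG [l m]; split=> [c p q|p q]; rewrite -!FG ?l ?m. Qed.

Lemma derivation_comm F G : derivation F -> derivation G ->
  derivation (fun p => F (G p) - G (F p)).
Proof.
move=> [lF mF] [lG mG]; split=> [a p q|p q].
  by rewrite !(lF, lG) scalerBr opprD addrACA.
rewrite mF mG (linD lF) (linD lG) !(mF, mG) mulrBr mulrBl.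
by rewrite comm_leibniz.
Qed.

Lemma derivation_mull a F : derivation F -> derivation (fun p => a * F p).
Proof.
move=> [lF mF]; split=> [c p q|p q]; first by rewrite lF mulrDr scalerAr.
by rewrite mF mulrDr mulrCA (mulrA a (F p)).
Qed.

Lemma der_lin c d1 d2 :
  der (fun i => c *: d1 i + d2 i) =1 (fun p => c *: der d1 p + der d2 p).
Proof.
apply: derivation_ext => [||i]; first exact: der_derivation.
  by apply: derivation_lin; apply: der_derivation.
by rewrite !der_gen.
Qed.

Lemma eq_der d1 d2 : d1 =1 d2 -> der d1 =1 der d2.
Proof.
move=> e; apply: derivation_ext => [||i]; try exact: der_derivation.
by rewrite !der_gen e.
Qed.

Section PoissonBracket.
Variables (b : I -> I -> A) (d0 : I -> A).

(** [ham u] is the Hamiltonian derivation of [gen u]; extending it in the first argument gives the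
    biderivation with values [b] on generators. *)
Definition ham (u : I) : A -> A := der (b u).
Definition poly_brk (p q : A) : A := der (fun u => ham u q) p.
Definition poly_der : A -> A := der d0.

Lemma poly_brk_gen u v : poly_brk (gen u) (gen v) = b u v.
Proof. by rewrite /poly_brk der_gen /ham der_gen. Qed.
Lemma poly_der_gen u : poly_der (gen u) = d0 u.
Proof. exact: der_gen. Qed.

Lemma poly_brk_der_l q : derivation (poly_brk^~ q).
Proof. exact: der_derivation. Qed.

Lemma poly_brk_lin_r p : linear (poly_brk p).
Proof.
move=> c x y; rewrite /poly_brk -der_lin; apply: eq_der => u.
exact: (der_derivation _).1.
Qed.

(** Both sides of the Leibniz rule in the second argument are derivations in the first, so they are
    compared on generators, where the bracket is [ham]. *)
Lemma poly_brk_der_r p : derivation (poly_brk p).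
Proof.
split=> [|x y]; first exact: poly_brk_lin_r.
have := @derivation_ext (poly_brk^~ (x * y))
  (fun p => x * poly_brk p y + y * poly_brk p x).
have d1 z w : derivation (fun p => z * poly_brk p w).
  exact: derivation_mull (poly_brk_der_l w).
have d2 : derivation (fun p => x * poly_brk p y + y * poly_brk p x).
  have [l m] := derivation_lin 1 (d1 x y) (d1 y x).
  by split=> [c u v|u v]; rewrite -[x * _]scale1r ?l ?m ?scale1r.
move=> /(_ (poly_brk_der_l _) d2) -> => [|u]; first by rewrite (mulrC y).
by rewrite /poly_brk !der_gen /ham (der_derivation _).2 (mulrC y).
Qed.

Hypothesis b_anti : forall u v, b u v = - b v u.

Lemma poly_brk_anti p q : poly_brk p q = - poly_brk q p.
Proof.
have negd F : derivation F -> derivation (fun p => - F p).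
  move=> [l m]; split=> [c x y|x y]; first by rewrite l opprD scalerN.
  by rewrite m opprD mulrN mulNr.
apply: (@derivation_ext (poly_brk^~ q) (fun p => - poly_brk q p)) p => [||u].
- exact: poly_brk_der_l.
- exact/negd/poly_brk_der_r.
apply: (@derivation_ext (poly_brk (gen u)) (fun q => - poly_brk q (gen u))) q => [||v].
- exact: poly_brk_der_r.
- exact/negd/poly_brk_der_l.
by rewrite !poly_brk_gen.
Qed.

Hypothesis b_jacobi : forall u v w,
  poly_brk (gen u) (b v w) + poly_brk (gen v) (b w u) + poly_brk (gen w) (b u v) = 0.

Definition jacobiator p q r :=
  poly_brk p (poly_brk q r) + poly_brk q (poly_brk r p) + poly_brk r (poly_brk p q).

Lemma jacobiatorC p q r : jacobiator p q r = jacobiator q r p.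
Proof. by rewrite /jacobiator -addrA addrC. Qed.

(** By anticommutativity the jacobiator is the commutator of the derivations {p, -} and {q, -} minus
    {{p, q}, -}, applied to the third argument. *)
Lemma jacobiator_der p q : derivation (jacobiator p q).
Proof.
have E r : poly_brk p (poly_brk q r) - poly_brk q (poly_brk p r)
           - poly_brk (poly_brk p q) r = jacobiator p q r.
  by rewrite /jacobiator (poly_brk_anti r p) (poly_brk_anti r) (linN (poly_brk_lin_r q)).
apply: derivation_eq E _; apply: derivation_sub (poly_brk_der_r _).
by apply: derivation_comm; apply: poly_brk_der_r.
Qed.

Lemma jacobiator_gen p q r :
  (forall w, jacobiator p q (gen w) = 0) -> jacobiator p q r = 0.
Proof.
by move=> H; apply: (derivation_ext (jacobiator_der p q) derivation0).
Qed.

Lemma poly_brk_jacobi p q r : jacobiator p q r = 0.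
Proof.
(* Cyclic symmetry brings each argument in turn to the last place, where it may be taken to be a
   generator. *)
apply: jacobiator_gen => w; rewrite -jacobiatorC.
apply: jacobiator_gen => v; rewrite -jacobiatorC.
by apply: jacobiator_gen => u; rewrite /jacobiator !poly_brk_gen.
Qed.

Hypothesis d_b : forall u v,
  poly_der (b u v) = poly_brk (d0 u) (gen v) + poly_brk (gen u) (d0 v).

Lemma poly_der_brk p q :
  poly_der (poly_brk p q) = poly_brk (poly_der p) q + poly_brk p (poly_der q).
Proof.
have dd : derivation poly_der by apply: der_derivation.
(* [err p] is the commutator of the derivation with {p, -}, minus {d p, -}: again a derivation, and
   antisymmetric in its two arguments. *)
pose err p q := poly_der (poly_brk p q) - poly_brk p (poly_der q) - poly_brk (poly_der p) q.
have errC x y : err x y = - err y x.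
  rewrite /err (poly_brk_anti y x) (linN dd.1) (poly_brk_anti y).
  rewrite (poly_brk_anti (poly_der y)).
  by rewrite !opprK !opprD !opprK addrAC.
have err_der x : derivation (err x).
  apply: derivation_sub (poly_brk_der_r _); apply: (derivation_comm dd).
  exact: poly_brk_der_r.
have err0 x y : (forall v, err x (gen v) = 0) -> err x y = 0.
  by move=> H; apply: (derivation_ext (err_der x) derivation0).
have : err p q = 0.
  rewrite err0 // => v; rewrite errC err0 ?oppr0 // => u.
  by rewrite /err !poly_der_gen poly_brk_gen d_b addrK subrr.
by rewrite /err => /subr0_eq /eqP; rewrite subr_eq => /eqP.
Qed.
End PoissonBracket.
End Derivations.

(** * Gaussian elimination in relatively free algebras *)

Section IntegerCombinations.
Variables (k : fieldType) (U : lmodType k).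

Definition icomb (X : Type) (f : X -> U) (s : seq (int * X)) : U :=
  \sum_(cx <- s) cx.1%:~R *: f cx.2.

Lemma icomb_nil (X : Type) (f : X -> U) : icomb f [::] = 0.
Proof. exact: big_nil. Qed.

Lemma icomb_cons (X : Type) (f : X -> U) c x s :
  icomb f ((c, x) :: s) = c%:~R *: f x + icomb f s.
Proof. exact: big_cons. Qed.

Lemma icomb1 (X : Type) (f : X -> U) x : icomb f [:: (1, x)] = f x.
Proof. by rewrite icomb_cons icomb_nil addr0 scale1r. Qed.

Lemma icomb_cat (X : Type) (f : X -> U) s t :
  icomb f (s ++ t) = icomb f s + icomb f t.
Proof. exact: big_cat. Qed.

Lemma icomb_flatten (X Y : Type) (f : X -> U) (g : Y -> seq (int * X)) s :
  icomb f (flatten [seq g y | y <- s]) = \sum_(y <- s) icomb f (g y).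
Proof.
elim: s => [|y s IH] /=; first by rewrite icomb_nil big_nil.
by rewrite icomb_cat big_cons IH.
Qed.

Lemma icomb_map (X Y : Type) (f : X -> U) (h : Y -> X) c s :
  icomb f [seq (c * dy.1, h dy.2) | dy <- s] = c%:~R *: icomb (f \o h) s.
Proof.
rewrite /icomb big_map scaler_sumr; apply: eq_bigr => -[d y] _ /=.
by rewrite intrM scalerA.
Qed.

Lemma icomb_map1 (X Y : Type) (f : X -> U) (h : Y -> X) s :
  icomb f [seq (dy.1, h dy.2) | dy <- s] = icomb (f \o h) s.
Proof. by rewrite /icomb big_map. Qed.

Lemma icomb_opp (X : Type) (f : X -> U) s :
  icomb f [seq (- dy.1, dy.2) | dy <- s] = - icomb f s.
Proof.
rewrite /icomb big_map -sumrN; apply: eq_bigr => dx _ /=.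
by rewrite mulrNz scaleNr.
Qed.


Lemma eq_icomb (X : Type) (f g : X -> U) s : f =1 g -> icomb f s = icomb g s.
Proof. by move=> fg; apply: eq_bigr => cx _; rewrite fg. Qed.

Lemma eq_in_icomb (X : eqType) (f g : X -> U) (s : seq (int * X)) :
  {in s, forall cx, f cx.2 = g cx.2} -> icomb f s = icomb g s.
Proof.
by move=> fg; rewrite /icomb !big_seq; apply: eq_bigr => cx /fg ->.
Qed.




Lemma icomb_comp (X Y : Type) (f : X -> U) (g : Y -> seq (int * X)) s :
  icomb f (flatten [seq [seq (cy.1 * dx.1, dx.2) | dx <- g cy.2] | cy <- s]) =
  icomb (fun y => icomb f (g y)) s.
Proof. by rewrite icomb_flatten; apply: eq_bigr => cy _; rewrite (icomb_map f id). Qed.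
End IntegerCombinations.

Lemma lin_icomb (k : fieldType) (U W : lmodType k) (F : U -> W) (X : Type)
    (f : X -> U) s :
  linear F -> F (icomb f s) = icomb (F \o f) s.
Proof.
by move=> lF; rewrite (lin_sum lF); apply: eq_bigr => cx _; rewrite (linZ lF).
Qed.

Definition zpoly := seq (int * gdmonom).

(* With this order, every row met by the elimination below gets (possibly after
   being deferred once) a leading coefficient 1, -1, 2 or -2 dividing the row.
   Soundness does not depend on the order. *)
Fixpoint tcmp (s t : gdmonom) : comparison :=
  match s, t with
  | MVar i, MVar j => Nat.compare i j
  | MVar _, _ => Lt
  | _, MVar _ => Gt
  | MCirc a b, MCirc c d | MBrk a b, MBrk c d =>
      match Nat.compare (mdegree c) (mdegree a) with
      | Eq => match tcmp a c with Eq => tcmp b d | r => r end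
      | r => r
      end
  | MCirc a b, MBrk c d =>
      match Nat.compare (mdegree c) (mdegree a) with Eq => Lt | r => r end
  | MBrk a b, MCirc c d =>
      match Nat.compare (mdegree c) (mdegree a) with Eq => Gt | r => r end
  end.

(* Merging assumes decreasing lists of monomials; the value of the sum does not
   depend on it. *)
Fixpoint padd (p : zpoly) : zpoly -> zpoly :=
  match p with
  | [::] => id
  | (a, s) :: p' =>
      fix padd_p (q : zpoly) :=
        match q with
        | [::] => (a, s) :: p'
        | (b, t) :: q' =>
            match tcmp s t with
            | Gt => (a, s) :: padd p' q
            | Lt => (b, t) :: padd_p q'
            | Eq => match a + b with
                    | 0%Z => padd p' q'
                    | c => (c, s) :: padd p' q'
                    end
            end
        end
  end.

Arguments padd : simpl never.

Definition pscale (c : int) (p : zpoly) : zpoly :=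
  match c with
  | 1%Z => p
  | _ => [seq (c * x.1, x.2) | x <- p]
  end.

(** An entry [(t, q)] is the rewriting rule that replaces the monomial [t] by [q]. *)
Inductive trie : Type := TLeaf | TNode of option (gdmonom * zpoly) & trie & trie.

Fixpoint tget (m : trie) (key : seq bool) :=
  match m, key with
  | TLeaf, _ => None
  | TNode v _ _, [::] => v
  | TNode _ l r, b :: key' => tget (if b then l else r) key'
  end.

Fixpoint tset (key : seq bool) (v : gdmonom * zpoly) (m : trie) : trie :=
  match key, m with
  | [::], TLeaf => TNode (Some v) TLeaf TLeaf
  | [::], TNode _ l r => TNode (Some v) l r
  | true :: key', TLeaf => TNode None (tset key' v TLeaf) TLeaf
  | false :: key', TLeaf => TNode None TLeaf (tset key' v TLeaf)
  | true :: key', TNode w l r => TNode w (tset key' v l) r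
  | false :: key', TNode w l r => TNode w l (tset key' v r)
  end.

Fixpoint tcode (t : gdmonom) (acc : seq bool) : seq bool :=
  match t with
  | MVar i => false :: iter i (cons true) (false :: acc)
  | MCirc s t => true :: true :: tcode s (tcode t acc)
  | MBrk s t => true :: false :: tcode s (tcode t acc)
  end.

(* Entries carry their own key, so that [tcode] need not be proved injective. *)
Definition lookup (m : trie) (t : gdmonom) : option zpoly :=
  match tget m (tcode t [::]) with
  | Some (s, p) => match tcmp s t with Eq => Some p | _ => None end
  | None => None
  end.

(** Rewrites whole monomials only; subterms are left to [nf], which multiplies factors already
    reduced. *)
Fixpoint reduce (n : nat) (m : trie) (p : zpoly) : zpoly :=
  match n, p with
  | n'.+1, (c, t) :: p' =>
      match lookup m t with
      | Some q => reduce n' m (padd (pscale c q) p')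
      | None => (c, t) :: reduce n' m p'
      end
  | _, _ => p
  end.

(** Exhausting this bound leaves a polynomial of the same value, so it can affect the success of the
    final check but not soundness. *)
Definition fuel : nat := 2000.

Fixpoint pmulrow (op : gdmonom -> gdmonom -> gdmonom) (a : int) (s : gdmonom)
    (q : zpoly) : zpoly :=
  match q with
  | [::] => [::]
  | (b, t) :: q' => padd [:: (a * b, op s t)] (pmulrow op a s q')
  end.

Fixpoint pmulop (op : gdmonom -> gdmonom -> gdmonom) (p q : zpoly) : zpoly :=
  match p with
  | [::] => [::]
  | (a, s) :: p' => padd (pmulrow op a s q) (pmulop op p' q)
  end.

Definition pmulop_nf m op p q := reduce fuel m (pmulop op p q).

Fixpoint nf (m : trie) (t : gdmonom) : zpoly :=
  match t with
  | MVar i => [:: (1, t)]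
  | MCirc s t => pmulop_nf m MCirc (nf m s) (nf m t)
  | MBrk s t => pmulop_nf m MBrk (nf m s) (nf m t)
  end.

Definition nf_comb (m : trie) (p : zpoly) : zpoly :=
  foldr (fun x q => padd (pscale x.1 (nf m x.2)) q) [::] p.

Definition isnil (A : Type) (s : seq A) := if s is [::] then true else false.

Definition neg1 : int := -1.

Definition ax_as (a b : gdmonom) : zpoly := [:: (1, MBrk a b); (1, MBrk b a)].
Definition ax_jac a b c : zpoly :=
  [:: (1, MBrk a (MBrk b c)); (1, MBrk b (MBrk c a)); (1, MBrk c (MBrk a b))].
Definition ax_ls a b c : zpoly :=
  [:: (1, MCirc (MCirc a b) c); (neg1, MCirc a (MCirc b c));
      (neg1, MCirc (MCirc b a) c); (1, MCirc b (MCirc a c))].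
Definition ax_rc a b c : zpoly :=
  [:: (1, MCirc (MCirc a b) c); (neg1, MCirc (MCirc a c) b)].
Definition ax_gd a b c : zpoly :=
  [:: (1, MCirc b (MBrk a c)); (neg1, MBrk a (MCirc b c)); (1, MBrk c (MCirc b a));
      (neg1, MCirc (MBrk b a) c); (1, MCirc (MBrk b c) a)].
Definition ax_1 a b c d : zpoly :=
  [:: (1, MCirc (MBrk c (MCirc a d)) b); (1, MCirc (MCirc (MBrk a c) d) b);
      (neg1, MBrk c (MCirc (MCirc a b) d)); (1, MCirc (MBrk c (MCirc a b)) d)].
Definition ax_2 a b c d : zpoly :=
  [:: (2%:Z, MCirc (MCirc (MBrk a b) c) d); (neg1, MBrk (MCirc b c) (MCirc a d));
      (1, MBrk (MCirc a c) (MCirc b d)); (neg1, MCirc (MBrk a (MCirc b c)) d);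
      (1, MCirc (MBrk b (MCirc a c)) d); (neg1, MCirc (MBrk a (MCirc b d)) c);
      (1, MCirc (MBrk b (MCirc a d)) c)].

(* The coefficients of [- p / c], when [c] is [1], [-1], [2] or [-2] and divides [p]. *)
Definition divu (c a : int) : option int :=
  match c with
  | Posz 1 => Some (- a)
  | Negz 0 => Some a
  | Posz 2 => let b := (a %/ 2)%Z in if a == (2 * b)%R then Some (- b) else None
  | Negz 1 => let b := (a %/ 2)%Z in if a == (2 * b)%R then Some b else None
  | _ => None
  end.

Fixpoint pdivu (c : int) (p : zpoly) : option zpoly :=
  match p with
  | [::] => if divu c 0 is Some _ then Some [::] else None
  | (a, t) :: p' =>
      match divu c a, pdivu c p' with
      | Some b, Some q => Some ((b, t) :: q)
      | _, _ => None
      end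
  end.

(* The second component collects the rows whose leading coefficient cannot be
   inverted yet. *)
Definition insert (st : trie * seq zpoly) (r : zpoly) : trie * seq zpoly :=
  match reduce fuel st.1 r with
  | [::] => st
  | (c, t) :: p =>
      match pdivu c p with
      | Some q => (tset (tcode t [::]) (t, q) st.1, st.2)
      | None => (st.1, ((c, t) :: p) :: st.2)
      end
  end.

Fixpoint subsplits (s : seq nat) : seq (seq nat * seq nat) :=
  match s with
  | [::] => [:: ([::], [::])]
  | x :: s' => flatten [seq [:: (x :: z.1, z.2); (z.1, x :: z.2)] | z <- subsplits s']
  end.
Definition nonnil (s : seq nat) := if s is [::] then false else true.
Definition splits2 (s : seq nat) :=
  [seq z <- subsplits s | nonnil z.1 && nonnil z.2].

Fixpoint splits (k : nat) (s : seq nat) : seq (seq (seq nat)) :=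
  match k with
  | 0 => [::]
  | 1 => [:: [:: s]]
  | k'.+1 => flatten [seq [seq z.1 :: l | l <- splits k' z.2] | z <- splits2 s]
  end.

Fixpoint choices (bs : seq (seq gdmonom)) : seq (seq gdmonom) :=
  match bs with
  | [::] => [:: [::]]
  | b :: bs' => flatten [seq [seq x :: l | l <- choices bs'] | x <- b]
  end.

Fixpoint natl_eq (s t : seq nat) : bool :=
  match s, t with
  | [::], [::] => true
  | x :: s', y :: t' => eqn x y && natl_eq s' t'
  | _, _ => false
  end.

Definition bases := seq (seq nat * seq gdmonom).
Fixpoint lookup_basis (bs : bases) (s : seq nat) : seq gdmonom :=
  match bs with
  | [::] => [::]
  | (s', b) :: bs' => if natl_eq s s' then b else lookup_basis bs' s
  end.

Definition isnone (A : Type) (x : option A) := if x is None then true else false.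
(** Products of smaller basis monomials that no rule rewrites, intended to span the multilinear
    component on [s] modulo the identities. *)
Definition new_basis (m : trie) (bs : bases) (s : seq nat) : seq gdmonom :=
  flatten [seq flatten [seq flatten [seq
     [seq x <- [:: MCirc a b; MBrk a b] | isnone (lookup m x)]
     | b <- lookup_basis bs z.2] | a <- lookup_basis bs z.1] | z <- splits2 s].

(** The identities are multilinear, so they are instantiated at basis monomials of complementary
    variable sets only. *)
Definition basis_tuples k bs s :=
  flatten [seq choices [seq lookup_basis bs z | z <- sp] | sp <- splits k s].

Definition row2 f (l : seq gdmonom) : zpoly :=
  if l is [:: a; b] then f a b else [::].
Definition row3 f (l : seq gdmonom) : zpoly :=
  if l is [:: a; b; c] then f a b c else [::].
Definition row4 f (l : seq gdmonom) : zpoly :=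
  if l is [:: a; b; c; d] then f a b c d else [::].

Definition gd_identities : seq (nat * (seq gdmonom -> zpoly)) :=
  [:: (2%N, row2 ax_as); (3%N, row3 ax_rc); (3%N, row3 ax_jac); (3%N, row3 ax_ls);
      (3%N, row3 ax_gd); (4%N, row4 ax_1); (4%N, row4 ax_2)].

(** Multiples of an identity in fewer variables are accounted for by [nf_comb], which normalises
    factors by the rules for smaller sets. Deferred rows get a second pass, when further rules may
    have made their leading coefficients invertible. *)
Definition extend_table (st : trie * bases) (s : seq nat) : trie * bases :=
  let: (m, bs) := st in
  let: (m, d) := foldl (fun st ax =>
      foldl (fun st l => insert st (nf_comb st.1 (ax.2 l))) st (basis_tuples ax.1 bs s))
    (m, [::]) gd_identities in
  let: (m, d) := foldl insert (m, [::]) d in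
  (m, (s, new_basis m bs s) :: bs).

Definition subsets_of_size n : seq (seq nat) :=
  [seq z.1 | z <- subsplits (iota 0 5) & eqn (size z.1) n].

Definition table_of (l : seq (seq nat)) : trie :=
  (foldl extend_table (TLeaf, [seq ([:: i], [:: MVar i]) | i <- iota 0 5]) l).1.

(** * Lie words *)

(* The letter [(i, j)] is the j-th derivative of the variable [i], a word
   [y1; ...; ym] denotes the left-normed bracket [..[y1, y2], .., ym], and a
   [mono] denotes the commutative product of its words. *)
Section Words.
Variable T : Type.
Definition letter := (T * nat)%type.
Definition word := seq letter.
Definition mono := seq word.
Definition lmono := seq (int * mono).

(* [eps w] expands the left-normed bracket of [w] into associative words. *)
Fixpoint epsl (Y : Type) (e : seq (int * seq Y)) (w : seq Y) : seq (int * seq Y) :=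
  if w is y :: w' then
    epsl (flatten [seq [:: (cu.1, rcons cu.2 y); (- cu.1, y :: cu.2)] | cu <- e]) w'
  else e.
Definition eps (Y : Type) (w : seq Y) : seq (int * seq Y) :=
  if w is y :: w' then epsl [:: (1, [:: y])] w' else [::].

Fixpoint dword (w : word) : seq word :=
  if w is y :: w' then ((y.1, y.2.+1) :: w') :: map (cons y) (dword w') else [::].
Fixpoint dmono (m : mono) : seq mono :=
  if m is w :: m' then map (cons^~ m') (dword w) ++ map (cons w) (dmono m') else [::].
(* The bracket of two Lie words: [v] acts on the right of [w] through its
   associative expansion. *)
Definition brw (w v : word) : seq (int * word) :=
  if w is [::] then [::] else [seq (cu.1, w ++ cu.2) | cu <- eps v].
Fixpoint picks (m : mono) : seq (word * mono) :=
  if m is w :: m' then (w, m') :: [seq (ur.1, w :: ur.2) | ur <- picks m'] else [::].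
Definition brm (m q : mono) : lmono :=
  flatten [seq flatten [seq [seq (cu.1, cu.2 :: wr.2 ++ vs.2) | cu <- brw wr.1 vs.1]
                       | vs <- picks q] | wr <- picks m].
End Words.

Section WordFacts.
Variable T : Type.

Lemma epsl_cat (Y : Type) (e : seq (int * seq Y)) w v :
  epsl e (w ++ v) = epsl (epsl e w) v.
Proof. by elim: w e => //= y w IH e; rewrite IH. Qed.

Lemma eps_rcons (Y : Type) (w : seq Y) y : w <> [::] ->
  eps (rcons w y) =
  flatten [seq [:: (cu.1, rcons cu.2 y); (- cu.1, y :: cu.2)] | cu <- eps w].
Proof. by case: w => // z w _ /=; rewrite -cats1 epsl_cat. Qed.

Lemma dword_cat (u v : word T) :
  dword (u ++ v) = [seq u' ++ v | u' <- dword u] ++ [seq u ++ v' | v' <- dword v].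
Proof.
elim: u => [|y u IH] /=; first by rewrite map_id.
by rewrite IH map_cat -!map_comp.
Qed.

Lemma brw_nonnil (w v : word T) : w <> [::] ->
  brw w v = [seq (cu.1, w ++ cu.2) | cu <- eps v].
Proof. by case: w. Qed.
End WordFacts.

(** The value of [t] in P^(d) in terms of products of Lie words; equal products are not
    collected. *)
Fixpoint norm (t : gdmonom) : lmono nat :=
  match t with
  | MVar i => [:: (1, [:: [:: (i, 0)]])]
  | MCirc s t => flatten [seq flatten [seq
      [seq (cm.1 * dq.1, cm.2 ++ z) | z <- dmono dq.2] | dq <- norm t] | cm <- norm s]
  | MBrk s t => flatten [seq flatten [seq
      [seq (cm.1 * dq.1 * ez.1, ez.2) | ez <- brm cm.2 dq.2] | dq <- norm t] | cm <- norm s]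
  end.

(** * The polynomial Poisson algebra on associative words *)

Section FreePoisson.
Variables (k : fieldType) (char_k : (2%:R : k) != 0).
Variables (A : comAlgType k) (gen : word nat -> A).
Hypothesis mon_ind : forall P : A -> Prop,
    P 0 -> (forall c p q, P p -> P q -> P (c *: p + q)) ->
    (forall s, P (\prod_(u <- s) gen u)) -> forall p, P p.
Variable ext : (seq (word nat) -> A) -> A -> A.
Hypothesis ext_linear : forall h, linear (ext h).
Hypothesis ext_mon : forall h, (forall s t, perm_eq s t -> h s = h t) ->
  forall s, ext h (\prod_(u <- s) gen u) = h s.

(** The linear Poisson structure of the free associative algebra under the commutator, with words as
    polynomial generators. It avoids constructing a basis of the free Lie algebra. *)
Definition word_brk (u v : word nat) : A := gen (u ++ v) - gen (v ++ u).
Definition word_der (u : word nat) : A := \sum_(v <- dword u) gen v.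

Local Notation "{ p , q }" := (poly_brk gen ext word_brk p q).
Local Notation d := (poly_der gen ext word_der).

Let brk_gen u v : { gen u, gen v } = gen (u ++ v) - gen (v ++ u).
Proof. exact: poly_brk_gen. Qed.
Let d_gen u : d (gen u) = \sum_(v <- dword u) gen v.
Proof. exact: poly_der_gen. Qed.
Let brk_der_l q : derivation (fun p => { p, q }).
Proof. exact: poly_brk_der_l. Qed.
Let brk_der_r p : derivation (fun q => { p, q }).
Proof. exact: poly_brk_der_r. Qed.
Let d_der : derivation d.
Proof. exact: der_derivation. Qed.
Let brk_linl q := (brk_der_l q).1.
Let brk_linr p := (brk_der_r p).1.

Lemma word_brk_anti u v : word_brk u v = - word_brk v u.
Proof. by rewrite /word_brk opprB. Qed.

Lemma assoc_jacobi (a b c p q r : A) :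
  a - b - (p - q) + (b - c - (r - p)) + (c - a - (q - r)) = 0.
Proof. by ring. Qed.

Lemma word_brk_jacobi u v w :
  { gen u, word_brk v w } + { gen v, word_brk w u } + { gen w, word_brk u v } = 0.
Proof.
rewrite /word_brk !(linB (brk_linr _)) !brk_gen -!catA.
exact: assoc_jacobi.
Qed.

Lemma word_der_brk u v :
  d (word_brk u v) = { word_der u, gen v } + { gen u, word_der v }.
Proof.
rewrite /word_brk (linB d_der.1) !d_gen !dword_cat !big_cat !big_map /=.
rewrite /word_der (lin_sum (brk_linl _)) (lin_sum (brk_linr _)).
under [X in _ = X + _]eq_bigr do rewrite brk_gen.
under [X in _ = _ + X]eq_bigr do rewrite brk_gen.
by rewrite !sumrB opprD [- _ - _]addrC addrACA.
Qed.

Fact mul_bilinear : bilinear_op (k := k) ( *%R : A -> A -> A).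
Proof. by split=> [q | p] c x y /=; rewrite ?mulrDl ?mulrDr -?scalerAl -?scalerAr. Qed.

Fact free_brk_lie : lie_op (fun p q : A => { p, q }).
Proof.
split; first by split=> [q | p] c x y; [exact: brk_linl | exact: brk_linr].
  (* Anticommutativity gives 2{p, p} = 0, and 2 is invertible. *)
  move=> p; apply/eqP.
  have /eqP := poly_brk_anti mon_ind ext_linear ext_mon word_brk_anti p p.
  rewrite -addr_eq0 -mulr2n -scaler_nat scaler_eq0 => /orP[|//].
  by rewrite (negPf char_k).
move=> p q r.
exact: (poly_brk_jacobi mon_ind ext_linear ext_mon word_brk_anti word_brk_jacobi).
Qed.

Fact free_brk_leibniz (x y z : A) : { x, y * z } = y * { x, z } + z * { x, y }.
Proof. by rewrite (brk_der_r x).2 [z * _]mulrC. Qed.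

Fact free_der_brk (x y : A) : d { x, y } = { d x, y } + { x, d y }.
Proof.
by apply: (poly_der_brk mon_ind ext_linear ext_mon word_brk_anti word_der_brk).
Qed.

Definition free_poisson_mixin := Lmodule_isDiffPoisson.Build k A
  mul_bilinear (@mulrA A) (@mulrC A) free_brk_lie free_brk_leibniz
  d_der.1 d_der.2 free_der_brk.
Definition free_poisson : diffPoissonType k :=
  HB.pack (GRing.ComAlgebra.sort A) free_poisson_mixin.

Section Evaluation.
Variable lam : nat -> nat.
(** Monomials are expanded with pairwise distinct variables; [lam] restores the repetitions. *)
Definition rlet (y : nat * nat) : nat * nat := (lam y.1, y.2).
Definition lval (y : nat * nat) : A := gen [:: rlet y].

Definition brks (p : A) (w : word nat) : A := foldl (fun q y => { q, lval y }) p w.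
Definition lword (w : word nat) : A := if w is y :: w' then brks (lval y) w' else 0.
Definition lmon (m : mono nat) : A := \prod_(w <- m) lword w.

Lemma brks_rcons p w y : brks p (rcons w y) = { brks p w, lval y }.
Proof. by rewrite /brks -cats1 foldl_cat. Qed.

Lemma lword_rcons w y : w <> [::] -> lword (rcons w y) = { lword w, lval y }.
Proof. by case: w => // z w _ /=; rewrite brks_rcons. Qed.

Lemma lword_cat w v : w <> [::] -> lword (w ++ v) = brks (lword w) v.
Proof. by case: w => // z w _ /=; rewrite /brks foldl_cat. Qed.

Lemma brk_adj p q r : { p, { q, r } } = { { p, q }, r } - { { p, r }, q }.
Proof.
have [_ _ J] := free_brk_lie.
have anti := poly_brk_anti mon_ind ext_linear ext_mon word_brk_anti.
have := J p q r; rewrite -addrA => /eqP; rewrite addr_eq0 => /eqP ->.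
by rewrite opprD -!anti (anti r p) (linN (brk_linl q)) addrC -(anti q).
Qed.

(** Bracketing on the right makes [A] a right module over the free associative algebra on the
    letters, and by the Jacobi identity a Lie word acts through its expansion there. Brackets of Lie
    words thus become left-normed. *)
Lemma brk_lword p v : { p, lword v } = icomb (brks p) (eps v).
Proof.
elim/last_ind: v p => [|v y IH] p; first by rewrite /= (lin0 (brk_linr _)) icomb_nil.
have [-> | v0] : v = [::] \/ v <> [::] by case: v {IH} => [|z v]; [left | right].
  by rewrite /= icomb1.
rewrite lword_rcons // eps_rcons // icomb_flatten brk_adj !IH.
rewrite (lin_icomb _ _ (brk_linl _)) /icomb -sumrB; apply: eq_bigr => -[c u] _ /=.
rewrite !big_cons big_nil addr0 /= mulrNz scaleNr -scalerBr.
by rewrite scalerBr brks_rcons.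
Qed.

Lemma lword_brk w v : { lword w, lword v } = icomb lword (brw w v).
Proof.
have [-> | w0] : w = [::] \/ w <> [::] by case: w => [|z w]; [left | right].
  by rewrite (lin0 (brk_linl _)) icomb_nil.
rewrite brw_nonnil // (icomb_map1 lword (cat w)) brk_lword.
by apply: eq_icomb => u /=; rewrite lword_cat.
Qed.

(** The bracket of two generators is their commutator, so left-normed brackets of one-letter
    generators follow the recursion of [eps]. *)
Lemma lword_gen w : lword w = icomb (fun u => gen (map rlet u)) (eps w).
Proof.
elim/last_ind: w => [|w y IH]; first by rewrite /= icomb_nil.
have [-> | w0] : w = [::] \/ w <> [::] by case: w {IH} => [|z w]; [left | right].
  by rewrite /= icomb1.
rewrite lword_rcons // eps_rcons // icomb_flatten IH.
rewrite (lin_icomb _ _ (brk_linl _)); apply: eq_bigr => -[c u] _ /=.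
rewrite !icomb_cons icomb_nil addr0 mulrNz scaleNr -scalerBr.
by rewrite brk_gen map_rcons cats1.
Qed.

Lemma d_lval x j : d (lval (x, j)) = lval (x, j.+1).
Proof. by rewrite d_gen /= big_seq1. Qed.

Lemma dword_rcons (w : word nat) y :
  dword (rcons w y) = rcons (map (rcons^~ y) (dword w)) (rcons w (y.1, y.2.+1)).
Proof.
rewrite -cats1 dword_cat /= -cats1; congr (_ ++ _); last by rewrite cats1.
by apply: eq_map => v; rewrite cats1.
Qed.

Lemma d_lword w : d (lword w) = \sum_(v <- dword w) lword v.
Proof.
elim/last_ind: w => [|w [x j] IH]; first by rewrite /= big_nil (lin0 d_der.1).
have [-> | w0] : w = [::] \/ w <> [::] by case: w {IH} => [|z w]; [left | right].
  by rewrite /= big_seq1 d_lval.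
rewrite lword_rcons // free_der_brk IH dword_rcons -cats1 big_cat big_seq1 big_map /=.
rewrite d_lval -lword_rcons // (lin_sum (brk_linl _)); congr (_ + _).
(* A derivative of a nonempty word is nonempty, as [lword_rcons] requires. *)
rewrite !big_seq; apply: eq_bigr => v vw; rewrite lword_rcons // => v0.
by move: vw; rewrite v0; case: w {IH w0} => //= z w; rewrite inE /=; elim: (dword w).
Qed.

Lemma d_lmon m : d (lmon m) = \sum_(z <- dmono m) lmon z.
Proof.
elim: m => [|w m IH] /=; first by rewrite /lmon !big_nil (derivation1 d_der).
rewrite /lmon big_cons -!/(lmon _) d_der.2 IH d_lword big_cat !big_map /= addrC.
rewrite mulr_suml mulr_sumr; congr (_ + _); apply: eq_bigr => z _.
  by rewrite /lmon big_cons.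
by rewrite /lmon big_cons.
Qed.

Lemma derivation_lmon F m : derivation F ->
  F (lmon m) = \sum_(wr <- picks m) F (lword wr.1) * lmon wr.2.
Proof.
move=> dF; elim: m => [|w m IH] /=; first by rewrite /lmon !big_nil (derivation1 dF).
rewrite /lmon !big_cons -!/(lmon _) dF.2 IH addrC big_map mulr_sumr; congr (_ + _).
by apply: eq_bigr => wr _ /=; rewrite /lmon big_cons mulrCA.
Qed.

Lemma brk_lmon m q : { lmon m, lmon q } = icomb lmon (brm m q).
Proof.
rewrite (derivation_lmon m (brk_der_l _)) icomb_flatten; apply: eq_bigr => -[w r] _ /=.
rewrite (derivation_lmon q (brk_der_r _)) icomb_flatten mulr_suml.
apply: eq_bigr => -[v s] _ /=; rewrite lword_brk (icomb_map1 lmon (fun u => u :: r ++ s)).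
rewrite -mulrA (lin_icomb _ _ (mullin _)); apply: eq_icomb => u /=.
by rewrite /lmon big_cons big_cat /= [X in _ * X]mulrC.
Qed.

Lemma meval_norm t :
  @meval k (derivedGD free_poisson) (fun i => lval (i, 0)) t = icomb lmon (norm t).
Proof.
elim: t => [i | s IHs t IHt | s IHs t IHt] /=.
- by rewrite icomb1 /lmon big_seq1.
- rewrite IHs IHt; change (icomb lmon (norm s) * d (icomb lmon (norm t)) =
    icomb lmon (flatten [seq flatten [seq [seq (cm.1 * dq.1, cm.2 ++ z) | z <- dmono dq.2]
                                      | dq <- norm t] | cm <- norm s])).
  rewrite (lin_icomb _ _ d_der.1) icomb_flatten mulr_suml; apply: eq_bigr => -[c m] _ /=.
  rewrite icomb_flatten mulr_sumr; apply: eq_bigr => -[e q] _ /=.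
  rewrite -scalerAl -scalerAr scalerA -intrM d_lmon /icomb big_map mulr_sumr scaler_sumr.
  by apply: eq_bigr => z _; rewrite /lmon big_cat.
rewrite IHs IHt; change ({ icomb lmon (norm s), icomb lmon (norm t) } =
  icomb lmon (flatten [seq flatten [seq
     [seq (cm.1 * dq.1 * ez.1, ez.2) | ez <- brm cm.2 dq.2] | dq <- norm t] | cm <- norm s])).
rewrite (lin_icomb _ _ (brk_linl _)) icomb_flatten; apply: eq_bigr => -[c m] _ /=.
rewrite (lin_icomb _ _ (brk_linr _)) icomb_flatten scaler_sumr.
apply: eq_bigr => -[e q] _ /=.
by rewrite (icomb_map lmon id) scalerA -intrM brk_lmon.
Qed.
End Evaluation.
End FreePoisson.

(** * Soundness of the elimination *)

Lemma tcmp_eq s t : tcmp s t = Eq -> s = t.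
Proof.
elim: s t => [i|a IHa b IHb|a IHa b IHb] [j|c d|c d] //=.
- by move/PeanoNat.Nat.compare_eq ->.
- by case: Nat.compare => //; case E: tcmp => // /IHb ->; rewrite (IHa _ E).
- by case: Nat.compare.
- by case: Nat.compare.
- by case: Nat.compare => //; case E: tcmp => // /IHb ->; rewrite (IHa _ E).
Qed.

Lemma padd_cons a s p b t q :
  padd ((a, s) :: p) ((b, t) :: q) =
  match tcmp s t with
  | Gt => (a, s) :: padd p ((b, t) :: q)
  | Lt => (b, t) :: padd ((a, s) :: p) q
  | Eq => match a + b with
          | 0%Z => padd p q
          | c => (c, s) :: padd p q
          end
  end.
Proof. by []. Qed.

Lemma divu_mul c a b : divu c a = Some b -> a = - (c * b).
Proof.
case: c => [[|[|[|n]]]|[|[|n]]] //=.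
- by case=> <-; rewrite mul1r opprK.
- by case: eqP => // e [] <-; rewrite mulrN opprK.
- by case=> <-; rewrite mulN1r opprK.
- by case: eqP => // e [] <-; rewrite {1}e -[Negz 1]/(- 2%:Z) mulNr opprK.
Qed.

Lemma divu_unit (k : fieldType) c a b : (2%:R : k) != 0 ->
  divu c a = Some b -> (c%:~R : k) != 0.
Proof.
move=> k2; case: c => [[|[|[|n]]]|[|[|n]]] //= _; rewrite ?oner_eq0 //.
- by rewrite oppr_eq0 oner_eq0.
by rewrite oppr_eq0.
Qed.

Fixpoint trie_all (P : gdmonom * zpoly -> Prop) (m : trie) : Prop :=
  if m is TNode v l r then
    [/\ if v is Some x then P x else True, trie_all P l & trie_all P r]
  else True.

Lemma trie_all_get P m key v : trie_all P m -> tget m key = Some v -> P v.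
Proof.
elim: m key => [|w l IHl r IHr] [|b key] //= [Pw Pl Pr].
  by move=> e; rewrite e in Pw.
by case: b; [apply: IHl | apply: IHr].
Qed.

Lemma trie_all_set P m key v : trie_all P m -> P v -> trie_all P (tset key v m).
Proof.
move=> + Pv; elim: key m => [|b key IH] [|w l r] //=.
- by case.
- by case: b; split=> //; apply: IH.
by case=> Pw Pl Pr; case: b; split=> //; apply: IH.
Qed.

Section Soundness.
Variables (k : fieldType) (char_k : (2%:R : k) != 0) (V : gdAlgType k).
Hypothesis V_id1 : forall a b c d : V,
  ({< c, a \circ d >} \circ b + ({< a, c >} \circ d) \circ b =
   {< c, (a \circ b) \circ d >} - {< c, a \circ b >} \circ d)%GD.
Hypothesis V_id2 : forall a b c d : V,
  ((({< a, b >} \circ c) \circ d) *+ 2 =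
   {< b \circ c, a \circ d >} - {< a \circ c, b \circ d >}
   + ({< a, b \circ c >} - {< b, a \circ c >}) \circ d
   + ({< a, b \circ d >} - {< b, a \circ d >}) \circ c)%GD.

Definition peval (y : nat -> V) (p : zpoly) : V := icomb (meval y) p.

Lemma gd_circ_linl (b : V) : linear (fun a : V => circ a b).
Proof. by have [[l _] _ _] := circ_novikov (s := V); exact: l. Qed.
Lemma gd_circ_linr (a : V) : linear (circ a).
Proof. by have [[_ l] _ _] := circ_novikov (s := V); exact: l. Qed.
Lemma gd_brk_linl (b : V) : linear (fun a : V => brk a b).
Proof. by have [[l _] _ _] := brk_lie (s := V); exact: l. Qed.
Lemma gd_brk_linr (a : V) : linear (brk a).
Proof. by have [[_ l] _ _] := brk_lie (s := V); exact: l. Qed.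

Section Valuation.
Variable y : nat -> V.

Lemma peval_padd p q : peval y (padd p q) = peval y p + peval y q.
Proof.
rewrite /peval; elim: p q => [|[a s] p IHp] q; first by rewrite icomb_nil add0r.
elim: q => [|[b t] q IHq]; first by rewrite icomb_nil addr0.
rewrite padd_cons; case E: (tcmp s t); rewrite ?icomb_cons.
- have -> : icomb (meval y) match a + b with
            | 0%Z => padd p q | c => (c, s) :: padd p q end
          = (a + b)%:~R *: meval y s + icomb (meval y) (padd p q).
    by case: (a + b) => [[|n]|n]; rewrite ?icomb_cons // scale0r add0r.
  by rewrite IHp (tcmp_eq E) intrD scalerDl addrACA.
- by rewrite IHq icomb_cons addrCA.
- by rewrite IHp icomb_cons -addrA.
Qed.

Lemma peval_pscale c p : peval y (pscale c p) = c%:~R *: peval y p.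
Proof.
have H : peval y [seq (c * x.1, x.2) | x <- p] = c%:~R *: peval y p.
  exact: (icomb_map (meval y) id).
by case: c H => [[|[|n]]|n] //; rewrite scale1r.
Qed.

(** Quantified over all valuations: rules found for the variables 0 to 4 are later used under
    arbitrary substitutions. *)
Definition entry_ok (tp : gdmonom * zpoly) : Prop :=
  forall y : nat -> V, meval y tp.1 = peval y tp.2.

Lemma lookup_ok m t q : trie_all entry_ok m -> lookup m t = Some q ->
  meval y t = peval y q.
Proof.
rewrite /lookup => ok; case E: tget => [[s p]|//]; case C: tcmp => // -[<-].
by rewrite -(tcmp_eq C); apply: (trie_all_get ok E).
Qed.

Lemma reduce_ok n m p : trie_all entry_ok m -> peval y (reduce n m p) = peval y p.
Proof.
move=> ok; elim: n p => [|n IH] [|[c t] p] //=.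
case E: lookup => [q|]; last by rewrite /peval !icomb_cons -!/(peval _ _) IH.
by rewrite IH peval_padd peval_pscale -(lookup_ok ok E) /peval icomb_cons.
Qed.

Lemma peval_pmulop op (f : V -> V -> V) p q :
    (forall s t, meval y (op s t) = f (meval y s) (meval y t)) ->
    (forall a, linear (f a)) -> (forall b, linear (f^~ b)) ->
  peval y (pmulop op p q) = f (peval y p) (peval y q).
Proof.
move=> opE linr linl.
have row a s : peval y (pmulrow op a s q) = a%:~R *: f (meval y s) (peval y q).
  elim: q => [|[b t] q IH] /=; first by rewrite /peval icomb_nil (lin0 (linr _)) scaler0.
  rewrite peval_padd IH /peval !icomb_cons icomb_nil addr0 opE intrM.
  by rewrite (linD (linr _)) (linZ (linr _)) scalerDr scalerA.
elim: p => [|[a s] p IH] /=; first by rewrite /peval icomb_nil (lin0 (linl _)).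
by rewrite peval_padd row IH /peval icomb_cons (linD (linl _)) (linZ (linl _)).
Qed.

Lemma nf_ok m t : trie_all entry_ok m -> peval y (nf m t) = meval y t.
Proof.
move=> ok; elim: t => [i|s IHs t IHt|s IHs t IHt] /=; first by rewrite /peval icomb1.
  rewrite /pmulop_nf reduce_ok // (@peval_pmulop _ (@circ k V)) ?IHs ?IHt //.
    exact: gd_circ_linr.
  exact: gd_circ_linl.
rewrite /pmulop_nf reduce_ok // (@peval_pmulop _ (@brk k V)) ?IHs ?IHt //.
  exact: gd_brk_linr.
exact: gd_brk_linl.
Qed.

Lemma nf_comb_ok m p : trie_all entry_ok m -> peval y (nf_comb m p) = peval y p.
Proof.
move=> ok; elim: p => [|[c t] p IH] //=.
by rewrite peval_padd peval_pscale nf_ok // IH /peval icomb_cons.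
Qed.
End Valuation.

Definition row_ok (p : zpoly) : Prop := forall y : nat -> V, peval y p = 0.

Lemma pdivu_ok y c p q : pdivu c p = Some q ->
  (c%:~R : k) != 0 /\ peval y p = - (c%:~R *: peval y q).
Proof.
elim: p q => [|[a t] p IH] q /=.
  case E: divu => // -[<-]; split; first exact: divu_unit E.
  by rewrite /peval icomb_nil scaler0 oppr0.
case E: divu => [b|//]; case F: pdivu => [q'|//] [<-].
have [c0 IHq] := IH _ F; split=> //.
rewrite /peval !icomb_cons -!/(peval _ _) IHq (divu_mul E) mulrNz intrM scaleNr.
by rewrite scalerDr scalerA opprD.
Qed.

Definition state_ok (st : trie * seq zpoly) : Prop :=
  trie_all entry_ok st.1 /\ (forall r, List.In r st.2 -> row_ok r).

Lemma insert_ok st r : state_ok st -> row_ok r -> state_ok (insert st r).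
Proof.
case: st => m d [okm okd] okr; rewrite /insert; move: fuel => n /=.
have := fun y => reduce_ok y n r okm; case: reduce => [|[c t] p] // E.
have E0 y : c%:~R *: meval y t + peval y p = 0.
  by rewrite -(okr y) -E /peval icomb_cons.
case F: pdivu => [q|]; split=> //=; last first.
  by move=> r' [<-|]; [move=> y; rewrite -(E0 y) /peval icomb_cons | apply: okd].
(* From [c t + p = 0] and [p = - c q] follows [t = q], since [c] is 1 or 2 up to sign and hence
   invertible in [k]. *)
apply: trie_all_set => // y; have [c0 Ep] := pdivu_ok y F.
by apply: (scalerI c0); apply/subr0_eq; rewrite -Ep E0.
Qed.

Lemma foldl_inv (S X : Type) (Inv : S -> Prop) (f : S -> X -> S) l st :
    (forall st x, List.In x l -> Inv st -> Inv (f st x)) ->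
  Inv st -> Inv (foldl f st l).
Proof.
elim: l st => [|x l IH] st //= H ok; apply: IH; last by apply: H => //; left.
by move=> st' x' lx'; apply: H; right.
Qed.

Lemma gd_identities_ok ax l : List.In ax gd_identities -> row_ok (ax.2 l).
Proof.
have [_ ls rc] := circ_novikov (s := V); have [_ alt jacobi] := brk_lie (s := V).
have anti (a b : V) : brk a b + brk b a = 0.
  have := alt (a + b); rewrite (linD (gd_brk_linl _)) !(linD (gd_brk_linr _)).
  by rewrite (alt a) (alt b) add0r addr0.
have sN (x : V) : neg1%:~R *: x = - x by rewrite mulrNz scaleN1r.
have s2 (x : V) : 2%:~R *: x = x *+ 2 by rewrite -scaler_nat.
pose E := (icomb_cons, icomb_nil, @scale1r k V, addr0, sN, s2).
move=> lax y; rewrite /peval; move: lax => /=.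
(* In each case an argument list of the wrong length gives the empty row, of value 0. *)
case=> [<-|].
  by case: l => [|a [|b [|? ?]]]; rewrite /= ?E // [LHS]anti.
case=> [<-|].
  case: l => [|a [|b [|c [|? ?]]]]; rewrite /= ?E //=.
  by rewrite rc subrr.
case=> [<-|].
  case: l => [|a [|b [|c [|? ?]]]]; rewrite /= ?E //=.
  by rewrite addrA jacobi.
case=> [<-|].
  case: l => [|a [|b [|c [|? ?]]]]; rewrite /= ?E //=.
  by rewrite addrA ls [- _ + _]addrC addrA subrK subrr.
case=> [<-|].
  case: l => [|a [|b [|c [|? ?]]]]; rewrite /= ?E //=.
  by apply/eqP; rewrite circ_brk addr_eq0 !opprD !opprK !addrA.
case=> [<-|].
  case: l => [|a [|b [|c [|d [|? ?]]]]]; rewrite /= ?E //=.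
  by rewrite addrA V_id1 [- _ + _]addrC addrA subrK subrr.
case=> [<-|//].
case: l => [|a [|b [|c [|d [|? ?]]]]]; rewrite /= ?E //=.
by apply/eqP; rewrite V_id2 !(linB (gd_circ_linl _)) addr_eq0 !opprD !opprK !addrA.
Qed.

Lemma extend_table_ok st s : trie_all entry_ok st.1 -> trie_all entry_ok (extend_table st s).1.
Proof.
case: st => m bs; rewrite /extend_table => okm.
have ok0 : state_ok (m, [::]) by split=> // r [].
have : state_ok (foldl (fun st ax =>
    foldl (fun st l => insert st (nf_comb st.1 (ax.2 l))) st (basis_tuples ax.1 bs s))
    (m, [::]) gd_identities).
  apply: foldl_inv ok0 => st ax lax ok; apply: foldl_inv ok => {}st l _ ok.
  by apply: insert_ok => // y; rewrite nf_comb_ok ?(gd_identities_ok l lax) //; case: ok.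
case: foldl => m1 d [ok1 okd].
have : state_ok (foldl insert (m1, [::]) d).
  by apply: foldl_inv => [st r lr ok|]; [apply: insert_ok => //; apply: okd | split=> // r []].
by case: foldl => m2 d' [].
Qed.

Lemma table_of_ok l : trie_all entry_ok (table_of l).
Proof.
rewrite /table_of.
apply: (foldl_inv (Inv := fun st => trie_all entry_ok st.1)) => // st s _.
exact: extend_table_ok.
Qed.

Lemma isnil_nf_comb m y p : trie_all entry_ok m -> isnil (nf_comb m p) -> peval y p = 0.
Proof.
move=> okm H; rewrite -(nf_comb_ok y p okm).
by case: nf_comb H => // _; rewrite /peval icomb_nil.
Qed.
End Soundness.

(** * From Poisson monomials to Gelfand--Dorfman polynomials *)

Definition ders (w : seq (nat * nat)) : nat := sumn (map snd w).
(** Drops the orders of the derivatives: it is meant for words without any. *)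
Definition lnb (w : seq (nat * nat)) : gdmonom :=
  if w is y :: w' then foldl (fun t z => MBrk t (MVar z.1)) (MVar y.1) w' else MVar 0.
Definition find_pick (a : pred (seq (nat * nat))) (m : mono nat) :=
  ohead [seq wr <- picks m | a wr.1].
Definition last_zero (w : seq (nat * nat)) := eqn (last (0, 0)%N w).2 0.
Definition psum (s : seq zpoly) : zpoly := foldr padd [::] s.

(* Each branch isolates [m] in a Leibniz rule:
   - if [m = x' r], then [m] is the value of [r \circ x];
   - if [m = x^(j) l r] with [j >= 2] and [l] without derivatives, then
     [l \circ (x^(j-1) r) = m + l x^(j-1) r'];
   - if [m = [u, y] r] with [y] a variable, then [[u r, y] = m + u [r, y]];
   - if [m = [u, y^(j)] r], the other variables without derivatives in [r] are
     distributed so that both arguments of [[u m1, y^(j) m2]] have weight -1.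
   The correctness of [phi] is never proved: only the relations tested by
   [check] are used. *)
Fixpoint phi (n : nat) (m : mono nat) : zpoly :=
  if n isn't n'.+1 then [::] else
  match m with
  | [:: w] => [:: (1, lnb w)]
  | _ =>
    match find_pick (fun w => if w is [:: (_, 1)] then true else false) m with
    | Some ((p, _) :: _, r) => pmulop MCirc (phi n' r) [:: (1, MVar p)]
    | _ =>
    match find_pick (fun w => if w is [:: (_, _.+2)] then true else false) m with
    | Some ((p, j) :: _, r) =>
        match find_pick (fun w => eqn (ders w) 0) r with
        | Some (l, r') =>
            padd (pmulop MCirc [:: (1, lnb l)] (phi n' ([:: (p, j.-1)] :: r')))
              (pscale neg1 (psum [seq phi n' (l :: [:: (p, j.-1)] :: z) | z <- dmono r']))
        | None => [::]
        end
    | _ =>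
    match find_pick (fun w => ~~ eqn (ders w) 0 && last_zero w) m with
    | Some (w, r) =>
        let u := take (size w).-1 w in let y := last (0, 0)%N w in
        padd (pmulop MBrk (phi n' (u :: r)) [:: (1, MVar y.1)])
          (pscale neg1 (psum [seq pscale cz.1 (phi n' (u :: cz.2)) | cz <- brm r [:: [:: y]]]))
    | None =>
    match find_pick (fun w => ~~ eqn (ders w) 0) m with
    | Some (w, r) =>
        let u := take (size w).-1 w in let y := last (0, 0)%N w in
        let ls := [seq v <- r | eqn (ders v) 0] in
        let m2 := [:: y] :: take y.2 ls in
        let m1 := u :: [seq v <- r | ~~ eqn (ders v) 0] ++ drop y.2 ls in
        padd (pmulop MBrk (phi n' m1) (phi n' m2))
          (psum [seq pscale cz.1 (phi n' cz.2) | cz <- drop (size (eps u)) (brm m2 m1)])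
    | None => [::]
    end end end end end.

(** * The finite list of relations to check *)

Fixpoint fillw (p : nat) (w : seq nat) : seq (nat * nat) :=
  if w is j :: w' then (p, j) :: fillw p.+1 w' else [::].
Fixpoint fill (p : nat) (s : seq (seq nat)) : mono nat :=
  if s is w :: s' then fillw p w :: fill (p + size w) s' else [::].

Definition shape (T : Type) (m : mono T) : seq (seq nat) := map (map snd) m.
Definition labels (T : Type) (m : mono T) : seq T := map fst (flatten m).

Fixpoint trename (f : nat -> nat) (t : gdmonom) : gdmonom :=
  match t with
  | MVar i => MVar (f i)
  | MCirc s t => MCirc (trename f s) (trename f t)
  | MBrk s t => MBrk (trename f s) (trename f t)
  end.

Definition phi_shape (s : seq (seq nat)) : zpoly := phi 20 (fill 0 s).
(** [phi] is run on distinct variables and the actual labels are substituted afterwards. This makes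
    the result natural in the labels, so that relations need checking for finitely many shapes
    only. *)
Definition phi_mono (m : mono nat) : zpoly :=
  let l := labels m in
  [seq (x.1, trename (nth (head 0%N l) l) x.2) | x <- phi_shape (shape m)].

(* Weight -1 means one derivative less than there are words. Products of a single
   word, i.e. Lie monomials, are excluded. *)
Definition admissible (s : seq (seq nat)) : bool :=
  [&& leq 2 (size s), eqn (sumn (map sumn s)) (size s).-1,
      leq (sumn (map size s)) 5 & all (fun w => leq 1 (size w)) s].

Fixpoint enumw (n d : nat) : seq (seq nat) :=
  if n is n'.+1 then
    [::] :: flatten [seq map (cons j) (enumw n' (d - j)) | j <- iota 0 d.+1]
  else [:: [::]].
Fixpoint enumm (k n d : nat) : seq (seq (seq nat)) :=
  if k is k'.+1 then
    [::] :: flatten [seq map (cons w) (enumm k' (n - size w) (d - sumn w))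
                    | w <- enumw n d & leq 1 (size w)]
  else [:: [::]].
Definition shapes : seq (seq (seq nat)) := [seq s <- enumm 5 5 4 | admissible s].

Definition swap (A : Type) (i : nat) (s : seq A) : seq A :=
  take i s ++ (if drop i s is a :: b :: r then b :: a :: r else drop i s).

(** Relations between left-normed words: antisymmetry and Jacobi at the start of the word, and in
    length 4 the antisymmetry of [[a, b], [c, d]], expanded. An admissible monomial has at least two
    nonempty words and degree at most 5, so its words have at most 4 letters. *)
Definition lie_rels (n : nat) : seq (seq (int * seq nat)) :=
  match n with
  | 2%N => [:: [:: (1, [:: 0; 1]%N); (1, [:: 1; 0]%N)]]
  | 3%N => [:: [:: (1, [:: 0; 1; 2]%N); (1, [:: 1; 0; 2]%N)];
             [:: (1, [:: 0; 1; 2]%N); (1, [:: 1; 2; 0]%N); (1, [:: 2; 0; 1]%N)]]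
  | 4%N => [:: [:: (1, [:: 0; 1; 2; 3]%N); (1, [:: 1; 0; 2; 3]%N)];
             [:: (1, [:: 0; 1; 2; 3]%N); (1, [:: 1; 2; 0; 3]%N); (1, [:: 2; 0; 1; 3]%N)];
             [:: (1, [:: 0; 1; 2; 3]%N); (neg1, [:: 0; 1; 3; 2]%N);
                 (1, [:: 2; 3; 0; 1]%N); (neg1, [:: 2; 3; 1; 0]%N)]]
  | _ => [::]
  end.

Definition swap_rel (s : seq (seq nat)) (i : nat) : zpoly :=
  phi_mono (fill 0 s) ++ [seq (- x.1, x.2) | x <- phi_mono (swap i (fill 0 s))].
(** The first word is enough, as the swaps bring any word to the front. *)
Definition word_rel (s : seq (seq nat)) (r : seq (int * seq nat)) : zpoly :=
  if fill 0 s is w :: m then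
    flatten [seq [seq (cp.1 * x.1, x.2) | x <- phi_mono ([seq nth (0, 0)%N w i | i <- cp.2] :: m)]
            | cp <- r]
  else [::].

Definition check_shape (tb : trie) (s : seq (seq nat)) : bool :=
  all (fun i => isnil (nf_comb tb (swap_rel s i))) (iota 0 (size s).-1)
  && all (fun r => isnil (nf_comb tb (word_rel s r))) (lie_rels (size (head [::] s))).

Fixpoint trees (f n p : nat) : seq gdmonom :=
  if f isn't f'.+1 then [::] else
  (if eqn n 1 then [:: MVar p] else [::]) ++
  flatten [seq flatten [seq flatten [seq [:: MCirc a b; MBrk a b]
    | b <- trees f' (n - i) (p + i)] | a <- trees f' i p] | i <- iota 1 n.-1].

Fixpoint pure (t : gdmonom) : bool :=
  match t with MVar _ => true | MCirc _ _ => false | MBrk s t => pure s && pure t end.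

Definition tree_rel (t : gdmonom) : zpoly :=
  (neg1, t) :: flatten [seq [seq (cm.1 * x.1, x.2) | x <- phi_mono cm.2] | cm <- norm t].
Definition check_tree (tb : trie) (t : gdmonom) : bool :=
  if pure t then all (fun cm => eqn (size cm.2) 1) (norm t) else
  all (fun cm => admissible (shape cm.2)) (norm t) && isnil (nf_comb tb (tree_rel t)).

Definition all_trees := flatten [seq trees 5 n 0 | n <- iota 1 5].
Definition check (tb : trie) : bool :=
  all (check_shape tb) shapes && all (check_tree tb) all_trees.

(** * Completeness of the enumerations, and relabelling *)

Section EnumerationFacts.

Lemma enumw_mem n d w : (size w <= n)%N -> (sumn w <= d)%N -> w \in enumw n d.
Proof.
elim: n d w => [|n IH] d w; first by case: w.
case: w => [|j w] sw dw; first exact: mem_head.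
have jd : (j <= d)%N := leq_trans (leq_addr _ _) dw.
rewrite in_cons; apply/orP; right; apply/flatten_mapP.
exists j; last apply: map_f.
  by rewrite (mem_iota 0 d.+1) add0n ltnS.
by apply: IH => //; rewrite leq_subRL.
Qed.

Lemma enumm_mem k n d s : (size s <= k)%N -> (sumn (map size s) <= n)%N ->
  (sumn (map sumn s) <= d)%N -> all (fun w => leq 1 (size w)) s -> s \in enumm k n d.
Proof.
elim: k n d s => [|k IH] n d s; first by case: s.
case: s => [|w s] ks ns ds; first by rewrite mem_head.
move=> /andP[w0 s0].
have nw : (size w <= n)%N := leq_trans (leq_addr _ _) ns.
have dw : (sumn w <= d)%N := leq_trans (leq_addr _ _) ds.
rewrite in_cons; apply/orP; right; apply/flatten_mapP.
exists w; last apply: map_f.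
  by rewrite mem_filter w0 enumw_mem.
by apply: IH; rewrite // leq_subRL.
Qed.

Lemma shapes_mem s : admissible s -> s \in shapes.
Proof.
move=> ds; rewrite mem_filter ds andTb; case/and4P: ds => _ /eqnP ds ns s0.
have ss : (size s <= sumn (map size s))%N.
  elim: s s0 {ds ns} => //= w s IH /andP[w0 /IH s0].
  by rewrite -add1n leq_add.
apply: enumm_mem => //; first exact: leq_trans ss ns.
by rewrite ds -subn1 leq_subLR (leq_trans ss ns).
Qed.

Fixpoint renumber (p : nat) (t : gdmonom) : gdmonom :=
  match t with
  | MVar _ => MVar p
  | MCirc s t => MCirc (renumber p s) (renumber (p + mdegree s) t)
  | MBrk s t => MBrk (renumber p s) (renumber (p + mdegree s) t)
  end.
Fixpoint leaves (t : gdmonom) : seq nat :=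
  match t with
  | MVar i => [:: i]
  | MCirc s t | MBrk s t => leaves s ++ leaves t
  end.

Lemma size_leaves t : size (leaves t) = mdegree t.
Proof. by elim: t => //= s IHs t IHt; rewrite size_cat IHs IHt. Qed.

Lemma mdegree_gt0 t : (0 < mdegree t)%N.
Proof. by elim: t => //= s IHs t IHt; rewrite addn_gt0 IHs. Qed.

(** Every tree is a substitution instance of the one whose leaves are numbered from left to right;
    the padding [a] and [b] carries the induction through both factors. *)
Lemma renumberK t a b :
  trename (nth 0%N (a ++ leaves t ++ b)) (renumber (size a) t) = t.
Proof.
elim: t a b => [i|s IHs t IHt|s IHs t IHt] a b /=.
- by rewrite nth_cat ltnn subnn.
- rewrite -catA IHs; congr MCirc.
  by rewrite -size_leaves -size_cat catA IHt.
rewrite -catA IHs; congr MBrk.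
by rewrite -size_leaves -size_cat catA IHt.
Qed.

Lemma pure_renumber p t : pure (renumber p t) = pure t.
Proof. by elim: t p => //= s IHs t IHt p; rewrite IHs IHt. Qed.

Lemma trees_mem f p t : (mdegree t <= f)%N -> renumber p t \in trees f (mdegree t) p.
Proof.
elim: f p t => [|f IH] p t; first by have := mdegree_gt0 t; case: mdegree.
have node s u : (mdegree s + mdegree u <= f.+1)%N ->
    forall x, x \in [:: MCirc (renumber p s) (renumber (p + mdegree s) u);
                        MBrk (renumber p s) (renumber (p + mdegree s) u)] ->
    x \in trees f.+1 (mdegree s + mdegree u) p.
  move=> le x xin; rewrite /= mem_cat; apply/orP; right.
  have s0 := mdegree_gt0 s; have u0 := mdegree_gt0 u.
  apply/flatten_mapP; exists (mdegree s).
    rewrite mem_iota s0 /=.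
    by rewrite add1n prednK ?addn_gt0 ?s0 // -[X in (X < _)%N]addn0 ltn_add2l.
  apply/flatten_mapP; exists (renumber p s).
    apply: IH.
    by rewrite -ltnS (leq_trans _ le) // -[X in (X < _)%N]addn0 ltn_add2l.
  apply/flatten_mapP; exists (renumber (p + mdegree s) u); last exact: xin.
  rewrite addKn; apply: IH.
  by rewrite -ltnS (leq_trans _ le) // -[X in (X < _)%N]add0n ltn_add2r.
case: t => [i _|s u le|s u le]; first by rewrite /= inE eqxx.
  by apply: node => //; rewrite inE eqxx.
by apply: node => //; rewrite !inE eqxx orbT.
Qed.

Lemma all_trees_mem t : (mdegree t <= 5)%N -> renumber 0 t \in all_trees.
Proof.
move=> le; apply/flatten_mapP; exists (mdegree t); last exact: trees_mem.
by rewrite (mem_iota 1 5) mdegree_gt0.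
Qed.
End EnumerationFacts.

Section Relabelling.
Variables (T U : Type) (f : T -> U).

Definition mapl (m : mono T) : mono U := map (map (fun y => (f y.1, y.2))) m.

Lemma shape_mapl m : shape (mapl m) = shape m.
Proof.
rewrite /shape /mapl -map_comp; apply: eq_map => w /=.
by rewrite -map_comp; apply: eq_map.
Qed.

Lemma labels_mapl m : labels (mapl m) = map f (labels m).
Proof.
rewrite /labels /mapl -map_flatten -!map_comp.
by apply: eq_map.
Qed.
End Relabelling.

Lemma fillwK (T : Type) (d : T) (w : word T) a b :
  [seq (nth d (a ++ map fst w ++ b) y.1, y.2) | y <- fillw (size a) (map snd w)] = w.
Proof.
elim: w a => [|[x j] w IH] a //=; rewrite nth_cat ltnn subnn /=; congr cons.
by have := IH (rcons a x); rewrite size_rcons cat_rcons.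
Qed.

(** A monomial is recovered from its shape and labels; the prefix [a] stands for the letters already
    numbered. *)
Lemma fillK (T : Type) (d : T) (m : mono T) a :
  mapl (nth d (a ++ labels m)) (fill (size a) (shape m)) = m.
Proof.
elim: m a => [|w m IH] a //=; rewrite /labels /= map_cat; congr cons.
  exact: fillwK.
by have := IH (a ++ map fst w); rewrite size_cat !size_map catA.
Qed.

Lemma map_swap (A B : Type) (f : A -> B) i s : map f (swap i s) = swap i (map f s).
Proof.
rewrite /swap map_cat map_take -map_drop; congr (_ ++ _).
by case: drop => [|a [|b r]].
Qed.

Lemma swap_cat (A : Type) (s : seq A) a b r :
  swap (size s) (s ++ a :: b :: r) = s ++ b :: a :: r.
Proof. by rewrite /swap take_size_cat // drop_size_cat. Qed.

Lemma nth_map_default (A B : Type) (f : A -> B) a s i :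
  nth (f a) (map f s) i = f (nth a s i).
Proof. by elim: s i => [|b s IH] [|i] /=. Qed.

Section MevalFacts.
Variables (k : fieldType) (V : gdAlgType k).

Lemma eq_meval (x y : nat -> V) t : x =1 y -> meval x t = meval y t.
Proof. by move=> e; elim: t => [i|s IHs t IHt|s IHs t IHt] /=; rewrite ?e ?IHs ?IHt. Qed.

Lemma meval_trename (y : nat -> V) f t : meval y (trename f t) = meval (y \o f) t.
Proof. by elim: t => [i|s IHs t IHt|s IHs t IHt] //=; rewrite IHs IHt. Qed.
End MevalFacts.

Lemma lie_rels_perm n r cp : r \in lie_rels n -> cp \in r -> perm_eq cp.2 (iota 0 n).
Proof.
have H : all (fun r => all (fun cp : int * seq nat => perm_eq cp.2 (iota 0 n)) r) (lie_rels n).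
  by case: n => [|[|[|[|[|n]]]]].
by move=> rn cpr; have /allP/(_ _ rn)/allP/(_ _ cpr) := H.
Qed.

(** * Values of monomials with letters in the target algebra *)

Section PhiValue.
Variables (k : fieldType) (V : gdAlgType k) (tb : trie).
Hypothesis tb_rel : forall (y : nat -> V) p, isnil (nf_comb tb p) -> peval y p = 0.
Hypothesis tb_check : check tb.

(** Elements of [V] themselves serve as letters. The value 0 on other shapes makes the relations
    trivial there, as they preserve admissibility. *)
Definition phi_val (m : mono V) : V :=
  let l := labels m in
  if admissible (shape m) then peval (nth (head 0 l) l) (phi_shape (shape m)) else 0.

Lemma admissible_labels (T : Type) (m : mono T) : admissible (shape m) -> labels m <> [::].
Proof.
case: m => [|[|[x j] w] m] //; first by case/and4P.
Qed.

Lemma phi_val_mapl (y : nat -> V) (m : mono nat) : admissible (shape m) ->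
  phi_val (mapl y m) = peval y (phi_mono m).
Proof.
move=> dm; rewrite /phi_val shape_mapl dm labels_mapl /phi_mono.
have := admissible_labels dm; case: (labels m) => // a l _ /=.
rewrite /peval (icomb_map1 (meval y) (trename (nth a (a :: l)))).
apply: eq_icomb => t /=; rewrite meval_trename; apply: eq_meval => i /=.
(* With the first label as default on both sides, [nth] commutes with relabelling at every index. *)
exact: (nth_map_default y a (a :: l) i).
Qed.

Lemma phi_val_undef m : ~~ admissible (shape m) -> phi_val m = 0.
Proof. by rewrite /phi_val => /negPf ->. Qed.

Lemma admissible_swap s a b r : admissible (s ++ a :: b :: r) = admissible (s ++ b :: a :: r).
Proof.
have p : perm_eq (s ++ a :: b :: r) (s ++ b :: a :: r).
  by rewrite perm_cat2l (perm_catCA [:: a] [:: b]).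
rewrite /admissible (perm_size p) (perm_sumn (perm_map sumn p)).
by rewrite (perm_sumn (perm_map size p)) (perm_all _ p).
Qed.

Lemma phi_val_swap s a b r : phi_val (s ++ a :: b :: r) = phi_val (s ++ b :: a :: r).
Proof.
pose m := s ++ a :: b :: r; pose m' := s ++ b :: a :: r.
have shm' : shape m' = swap (size s) (shape m).
  by rewrite /shape -map_swap /m swap_cat.
have dm' : admissible (shape m') = admissible (shape m).
  by rewrite /shape /m /m' !map_cat /= admissible_swap.
have [dm | dm] := boolP (admissible (shape m)); last by rewrite !phi_val_undef // dm'.
(* [m] is a relabelling of the monomial [M] of the same shape with distinct variables, for which the
   swap was checked. *)
pose y := nth 0 (labels m); pose M := fill 0 (shape m).
have mE : mapl y M = m by exact: (fillK 0 m [::]).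
have m'E : mapl y (swap (size s) M) = m' by rewrite /mapl map_swap -/(mapl y M) mE swap_cat.
have /andP[/allP/(_ _ (shapes_mem dm)) /andP[/allP sw _] _] := tb_check.
have /sw/(tb_rel y) : size s \in iota 0 (size (shape m)).-1.
  by rewrite mem_iota size_map size_cat /= !addnS /= ltnS leq_addr.
rewrite /peval icomb_cat icomb_opp => /subr0_eq.
rewrite -!/(peval y _) -!phi_val_mapl -/M ?m'E ?mE //.
  by rewrite -(shape_mapl y) m'E dm'.
by rewrite -(shape_mapl y) mE.
Qed.


Lemma admissible_perm (T : eqType) (w w' : word T) m :
  perm_eq w w' -> admissible (shape (w :: m)) = admissible (shape (w' :: m)).
Proof.
by move=> pw; rewrite /admissible /= !size_map (perm_size pw) (perm_sumn (perm_map snd pw)).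
Qed.

Lemma perm_nths (T : eqType) (x0 : T) p w : perm_eq p (iota 0 (size w)) ->
  perm_eq [seq nth x0 w i | i <- p] w.
Proof. by move=> pp; rewrite (perm_trans (perm_map _ pp)) // map_nth_iota0 // take_size. Qed.

Lemma phi_val_lie (w : word V) m r : r \in lie_rels (size w) ->
  icomb (fun p => phi_val ([seq nth (0, 0%N) w i | i <- p] :: m)) r = 0.
Proof.
move=> rw; have pp cp : cp \in r -> perm_eq cp.2 (iota 0 (size w)).
  exact: lie_rels_perm rw.
have [dm | dm] := boolP (admissible (shape (w :: m))); last first.
  rewrite /icomb big_seq big1 // => cp /pp pcp.
  by rewrite phi_val_undef ?scaler0 // (admissible_perm m (perm_nths _ pcp)).
pose y := nth 0 (labels (w :: m)).
pose W := fillw 0 (map snd w); pose M := fill (0 + size (map snd w)) (shape m).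
have [wE mE] : map (fun z => (y z.1, z.2)) W = w /\ mapl y M = m.
  by have := fillK 0 (w :: m) [::]; rewrite /= => -[-> ->].
have /andP[/allP/(_ _ (shapes_mem dm)) /andP[_ /allP rel] _] := tb_check.
have /rel/(tb_rel y) : r \in lie_rels (size (head [::] (shape (w :: m)))).
  by rewrite /= size_map.
rewrite /word_rel /= -/W -/M /peval.
rewrite (icomb_comp _ (fun p => phi_mono ([seq nth (0, 0)%N W i | i <- p] :: M))) => E.
rewrite -[RHS]E.
rewrite /icomb !big_seq; apply: eq_bigr => cp /pp pcp; congr (_ *: _).
have nthE : map (fun z => (y z.1, z.2)) [seq nth (0, 0)%N W i | i <- cp.2] =
            [seq nth (0, 0%N) w i | i <- cp.2].
  rewrite -map_comp; apply/eq_in_map => i; rewrite (perm_mem pcp) mem_iota /= => iw.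
  by rewrite -[in RHS]wE (nth_map (0, 0)%N) // -(size_map (fun z => (y z.1, z.2))) wE.
rewrite -[RHS]/(peval y (phi_mono ([seq nth (0, 0)%N W i | i <- cp.2] :: M))) -phi_val_mapl; first by rewrite /= nthE mE.
rewrite -(shape_mapl y) /= nthE [mapl y M]mE -/(shape (_ :: _)).
by rewrite (admissible_perm m (perm_nths _ pcp)).
Qed.

(** A tree of brackets only expands into single words, which are not admissible; every other tree
    was compared by [check_tree] with the value of [phi] on its expansion. *)
Lemma phi_val_norm (y : nat -> V) t : (mdegree t <= 5)%N ->
  let t0 := renumber 0 t in
  icomb (fun m => phi_val (mapl y m)) (norm t0) = if pure t then 0 else meval y t0.
Proof.
move=> le t0; have /andP[_ /allP/(_ _ (all_trees_mem le))] := tb_check.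
rewrite /check_tree -/t0 pure_renumber; case: (pure t) => [/allP H|/andP[/allP D]].
  rewrite /icomb big_seq big1 // => cm /H /eqnP s1.
  by rewrite phi_val_undef ?scaler0 // shape_mapl /admissible size_map s1.
move/(tb_rel y); rewrite /tree_rel /peval icomb_cons (icomb_comp _ phi_mono) mulrNz scaleN1r.
rewrite addrC => /subr0_eq <-; rewrite /icomb !big_seq.
by apply: eq_bigr => cm /D dcm; rewrite phi_val_mapl.
Qed.
End PhiValue.

(** * From associative words back to Lie words *)

Lemma eps_map (Y Z : Type) (f : Y -> Z) (w : seq Y) :
  eps (map f w) = [seq (cu.1, map f cu.2) | cu <- eps w].
Proof.
elim/last_ind: w => // w y IH.
have [-> // | w0] : w = [::] \/ w <> [::] by case: w {IH} => [|z w]; [left | right].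
rewrite map_rcons !eps_rcons //; last by case: w w0 {IH}.
by rewrite IH; elim: (eps w) => //= cu e ->; rewrite map_rcons.
Qed.

Section ScalarCombinations.
Variables (k : fieldType) (U : lmodType k).

Definition kcomb (X : Type) (f : X -> U) (s : seq (k * X)) : U :=
  \sum_(cx <- s) cx.1 *: f cx.2.

Lemma eq_kcomb (X : Type) (f g : X -> U) s : f =1 g -> kcomb f s = kcomb g s.
Proof. by move=> fg; apply: eq_bigr => cx _; rewrite fg. Qed.

Lemma kcomb_nil (X : Type) (f : X -> U) : kcomb f [::] = 0.
Proof. exact: big_nil. Qed.

Lemma kcomb_cons (X : Type) (f : X -> U) c x (s : seq (k * X)) :
  kcomb f ((c, x) :: s) = c *: f x + kcomb f s.
Proof. exact: big_cons. Qed.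

Lemma kcomb1 (X : Type) (f : X -> U) c x : kcomb f [:: (c, x)] = c *: f x.
Proof. exact: big_seq1. Qed.

Lemma kcomb_exchange (X Y : Type) (f : X -> Y -> U) s t :
  kcomb (fun x => kcomb (f x) t) s = kcomb (fun y => kcomb (f^~ y) s) t.
Proof.
rewrite /kcomb; under eq_bigr do rewrite scaler_sumr.
rewrite exchange_big; apply: eq_bigr => cy _; rewrite scaler_sumr.
by apply: eq_bigr => cx _; rewrite !scalerA mulrC.
Qed.

Lemma icomb_kcomb_exchange (X Y : Type) (f : X -> Y -> U) s t :
  icomb (fun x => kcomb (f x) t) s = kcomb (fun y => icomb (f^~ y) s) t.
Proof.
rewrite /icomb /kcomb; under eq_bigr do rewrite scaler_sumr.
rewrite exchange_big; apply: eq_bigr => cy _; rewrite scaler_sumr.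
by apply: eq_bigr => cx _; rewrite !scalerA mulrC.
Qed.
End ScalarCombinations.

Lemma addr_eqN (U : zmodType) (x y : U) : x + y = 0 -> y = - x.
Proof. by rewrite addrC => /eqP; rewrite addr_eq0 => /eqP. Qed.

(* Integer coordinates on five elements: linear identities between them are
   then closed by computation. *)
Lemma int_coordinates (U : zmodType) (x1 x2 x3 x4 x5 : U) :
  exists F : int -> int -> int -> int -> int -> U,
    [/\ forall i1 i2 i3 i4 i5 j1 j2 j3 j4 j5, F i1 i2 i3 i4 i5 + F j1 j2 j3 j4 j5 =
          F (i1 + j1) (i2 + j2) (i3 + j3) (i4 + j4) (i5 + j5),
        forall i1 i2 i3 i4 i5,
          - F i1 i2 i3 i4 i5 = F (- i1) (- i2) (- i3) (- i4) (- i5) &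
        [/\ x1 = F 1 0 0 0 0, x2 = F 0 1 0 0 0, x3 = F 0 0 1 0 0, x4 = F 0 0 0 1 0
          & x5 = F 0 0 0 0 1]].
Proof.
exists (fun i1 i2 i3 i4 i5 => x1 *~ i1 + (x2 *~ i2 + (x3 *~ i3 + (x4 *~ i4 + x5 *~ i5)))).
split=> [*|*|]; last by split; rewrite ?mulr0z ?mulr1z ?addr0 ?add0r.
  by do 4 (rewrite addrACA mulrzDr; congr (_ + _)); rewrite mulrzDr.
by rewrite !mulrNz !opprD.
Qed.

Lemma size_eps (Z : Type) (w : seq Z) cu : List.In cu (eps w) -> size cu.2 = size w.
Proof.
elim/last_ind: w cu => [|w y IH] cu //.
have [-> | w0] : w = [::] \/ w <> [::] by case: w {IH} => [|z w]; [left | right].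
  by case=> // <-.
rewrite eps_rcons // size_rcons.
elim: (eps w) IH => //= cv e IHe IH [<-|[<-|]] /=.
- by rewrite size_rcons IH //; left.
- by rewrite IH //; left.
by apply: IHe => cz z; apply: IH; right.
Qed.

Section Projection.
Variables (k : fieldType) (char_k : (2%:R : k) != 0) (Y : countType).

(* A projection of associative words onto left-normed Lie words of length at
   most 4: Dynkin's in lengths 2 and 4. In length 3 Dynkin's would divide by 3,
   so it is replaced by the degree 3 part of the Poincare--Birkhoff--Witt
   projection for the total order of [Y] given by [pickle]. *)
Definition lie_proj (u : seq Y) : seq (k * seq Y) :=
  match u with
  | [:: a] => [:: (1, u)]
  | [:: a; b] => [:: (2%:R^-1, u)]
  | [:: a; b; c] =>
      let gt x y := (choice.pickle y < choice.pickle x)%N in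
      if gt a b then (1, u) :: (if gt b c then [:: (1, [:: b; c; a])] else [::])
      else if gt a c then [:: (1, [:: a; c; b])] else [::]
  | [:: a; b; c; d] => [:: (4%:R^-1, u)]
  | _ => [::]
  end.

Variables (V : lmodType k) (g : seq Y -> V).
Hypothesis g0 : g [::] = 0.
Hypothesis g5 : forall u, (4 < size u)%N -> g u = 0.
Hypothesis g2 : forall a b, g [:: a; b] + g [:: b; a] = 0.
Hypothesis g3a : forall a b c, g [:: a; b; c] + g [:: b; a; c] = 0.
Hypothesis g3j : forall a b c, g [:: a; b; c] + g [:: b; c; a] + g [:: c; a; b] = 0.
Hypothesis g4a : forall a b c d, g [:: a; b; c; d] + g [:: b; a; c; d] = 0.
Hypothesis g4j : forall a b c d,
  g [:: a; b; c; d] + g [:: b; c; a; d] + g [:: c; a; b; d] = 0.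
Hypothesis g4d : forall a b c d,
  g [:: a; b; c; d] - g [:: a; b; d; c] + g [:: c; d; a; b] - g [:: c; d; b; a] = 0.

(** Antisymmetry and Jacobi express the six values of [g] by those on [[:: a; b; c]] and
    [[:: b; c; a]]; each relative order of the letters is then a computation. *)
Lemma lie_projK3 a b c :
  icomb (fun u => kcomb g (lie_proj u)) (eps [:: a; b; c]) = g [:: a; b; c].
Proof.
rewrite /eps [epsl _ _]/= !icomb_cons icomb_nil addr0.
rewrite !mulrNz ?mulrNz ?opprK !scaleN1r !scale1r.
have Ebac := addr_eqN (g3a a b c); have Ecba := addr_eqN (g3a b c a).
have Ecab := addr_eqN (g3j a b c); have Eacb := addr_eqN (g3a c a b).
rewrite Ecab in Eacb.
have [F [FD FN [Eabc Ebca _ _ _]]] := int_coordinates (g [:: a; b; c]) (g [:: b; c; a]) 0 0 0.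
pose E := (Ebac, Ecba, Eacb, Ecab, Eabc, Ebca, FN, FD).
pose S := (kcomb_cons, @kcomb_nil k V, @scale1r k V, @oppr0 V, @addr0 V, @add0r V).
rewrite /lie_proj.
case: (ltngtP (choice.pickle a) (choice.pickle b)) => ab;
case: (ltngtP (choice.pickle b) (choice.pickle c)) => bc;
case: (ltngtP (choice.pickle a) (choice.pickle c)) => ac; try (exfalso; lia);
  rewrite !S; try by rewrite !E.
(* Three equal letters remain: all projections vanish, and so does [g], since 2 is invertible. *)
have {}ab := pcan_inj choice.pickleK ab; subst b.
have /eqP := g3a a a c; rewrite -mulr2n -scaler_nat scaler_eq0 (negPf char_k) /=.
by move/eqP->.
Qed.

(** Dynkin's lemma in degree 4: the signed sum of [g] over the eight words of the expansion is four
    times its value. The relations reduce these words to the five used as coordinates. *)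
Lemma lie_projK4 a b c d :
  icomb (fun u => kcomb g (lie_proj u)) (eps [:: a; b; c; d]) = g [:: a; b; c; d].
Proof.
rewrite /eps [epsl _ _]/= !icomb_cons icomb_nil addr0 !kcomb1 !mulrNz ?mulrNz ?opprK.
rewrite !scaleN1r !scale1r -!scalerN -!scalerDr.
have Ebacd := addr_eqN (g4a a b c d); have Ecbad := addr_eqN (g4a b c a d).
have Ecabd := addr_eqN (g4j a b c d).
have Edcab := addr_eqN (g4a c d a b); have Edcba := addr_eqN (g4a c d b a).
have Edbac := addr_eqN (g4a b d a c); have Edabc := addr_eqN (g4j a b d c).
have Eabdc : g [:: a; b; d; c] = g [:: a; b; c; d] + g [:: c; d; a; b] - g [:: c; d; b; a].
  by apply/esym/subr0_eq; rewrite -[RHS](g4d a b c d) addrAC [X in X - _]addrAC.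
have [F [FD FN [E1 E2 E3 E4 E5]]] := int_coordinates (g [:: a; b; c; d])
  (g [:: b; c; a; d]) (g [:: c; d; a; b]) (g [:: c; d; b; a]) (g [:: b; d; a; c]).
rewrite Edabc Ebacd Ecbad Ecabd Edcab Edcba Edbac Eabdc E1 E2 E3 E4 E5 !(FN, FD).
transitivity ((4%:R : k)^-1 *: F 4 0 0 0 0); first by congr (_ *: F _ _ _ _ _).
have -> : F 4 0 0 0 0 = 4%:R *: F 1 0 0 0 0 :> V.
  set z := F 1 0 0 0 0; rewrite scaler_nat -[RHS]/(z + (z + (z + z))) /z.
  by rewrite !FD.
by rewrite scalerA mulVf ?scale1r // (natrM _ 2 2) mulf_neq0.
Qed.

Lemma lie_projK w : icomb (fun u => kcomb g (lie_proj u)) (eps w) = g w.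
Proof.
case: w => [|a [|b [|c [|d [|e w]]]]]; rewrite ?lie_projK3 ?lie_projK4 //.
- by rewrite icomb_nil g0.
- by rewrite icomb1 kcomb1 scale1r.
- rewrite /= !icomb_cons icomb_nil addr0 scale1r mulrNz scaleN1r !kcomb1 -scalerBr.
  by rewrite (addr_eqN (g2 a b)) opprK -mulr2n -scaler_nat scalerA mulVf ?scale1r.
(* Beyond length 4 both sides vanish: [eps] preserves the length, so every projection is empty. *)
rewrite g5 // /icomb; have H := @size_eps _ [:: a, b, c, d, e & w].
elim: (eps _) H => [|[z u] s IH] H; first by rewrite big_nil.
rewrite big_cons IH ?addr0 /=; last by move=> cu cus; apply: H; right.
have := H (z, u) (or_introl erefl).
by case: u {H} => [|? [|? [|? [|? [|? u]]]]] // _; rewrite kcomb_nil scaler0.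
Qed.
End Projection.

Section Functional.
Variables (k : fieldType) (char_k : (2%:R : k) != 0) (V : lmodType k).
Variable psi : mono nat -> V.
Hypothesis psi_undef : forall m, ~~ admissible (shape m) -> psi m = 0.
Hypothesis psi_swap : forall s a b r, psi (s ++ a :: b :: r) = psi (s ++ b :: a :: r).
Hypothesis psi_rel : forall (w : word nat) m r, r \in lie_rels (size w) ->
  icomb (fun p => psi ([seq nth (0, 0)%N w i | i <- p] :: m)) r = 0.

Lemma psi_perm s t : perm_eq s t -> psi s = psi t.
Proof. exact/(@adjacent_perm (word nat))/psi_swap. Qed.

Lemma psi_proj (w : word nat) m :
  icomb (fun u => kcomb (fun v => psi (v :: m)) (lie_proj k u)) (eps w) = psi (w :: m).
Proof.
have sN (v : V) : neg1%:~R *: v = - v by rewrite mulrNz scaleN1r.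
pose E := (icomb_cons, icomb_nil, sN, @scale1r k V, @addr0 V, @addrA V).
apply: (lie_projK char_k (g := fun v => psi (v :: m))).
- by rewrite psi_undef // /admissible /= !andbF.
(* A word of more than 4 letters leaves no room for a second nonempty word in degree at most 5. *)
- move=> u u5; rewrite psi_undef // /admissible; apply/and4P => -[/= m1 _ le].
  move=> /andP[_ al]; case: m m1 le al => //= v m _ le /andP[v0 _].
  move: le; rewrite !size_map in v0 *.
  by move/(leq_trans (leq_add u5 (leq_trans v0 (leq_addr _ _)))).
- by move=> a b; have := @psi_rel [:: a; b] m (nth [::] (lie_rels 2) 0) isT; rewrite /= !E.
- by move=> a b c; have := @psi_rel [:: a; b; c] m (nth [::] (lie_rels 3) 0) isT; rewrite /= !E.
- by move=> a b c; have := @psi_rel [:: a; b; c] m (nth [::] (lie_rels 3) 1) isT; rewrite /= !E.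
- move=> a b c d; have := @psi_rel [:: a; b; c; d] m (nth [::] (lie_rels 4) 0) isT.
  by rewrite /= !E.
- move=> a b c d; have := @psi_rel [:: a; b; c; d] m (nth [::] (lie_rels 4) 1) isT.
  by rewrite /= !E.
move=> a b c d; have := @psi_rel [:: a; b; c; d] m (nth [::] (lie_rels 4) 2) isT.
by rewrite /= !E.
Qed.

Fixpoint expand (s : seq (word nat)) : seq (k * mono nat) :=
  if s is u :: s' then
    [seq (cv.1 * dr.1, cv.2 :: dr.2) | cv <- lie_proj k u, dr <- expand s']
  else [:: (1, [::])].

Lemma kcomb_expand (f : mono nat -> V) u s :
  kcomb f (expand (u :: s)) =
  kcomb (fun v => kcomb (fun r => f (v :: r)) (expand s)) (lie_proj k u).
Proof.
rewrite /kcomb big_allpairs_dep; apply: eq_bigr => cv _ /=.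
by rewrite scaler_sumr; apply: eq_bigr => dr _; rewrite scalerA.
Qed.

Lemma kcomb_expand_swap (f : mono nat -> V) s a b r :
    (forall p v w q, f (p ++ v :: w :: q) = f (p ++ w :: v :: q)) ->
  kcomb f (expand (s ++ a :: b :: r)) = kcomb f (expand (s ++ b :: a :: r)).
Proof.
elim: s f => [|u s IH] f sw; last first.
  rewrite !cat_cons !kcomb_expand.
  by apply: eq_kcomb => v; apply: IH => p; exact: (sw (v :: p)).
rewrite !cat0s !kcomb_expand.
under eq_kcomb do rewrite kcomb_expand.
rewrite kcomb_exchange; apply: eq_kcomb => v; rewrite kcomb_expand.
by apply: eq_kcomb => w; apply: eq_kcomb => q; exact: (sw [::]).
Qed.

Definition psi_words (s : seq (word nat)) : V := kcomb psi (expand s).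

Lemma psi_words_perm s t : perm_eq s t -> psi_words s = psi_words t.
Proof.
apply: (@adjacent_perm (word nat)) => {}s a b r.
by apply: kcomb_expand_swap; exact: psi_swap.
Qed.

Variables (A : comAlgType k) (gen : word nat -> A) (Phi : A -> V).
Hypothesis Phi_linear : linear Phi.
Hypothesis Phi_gen : forall s, Phi (\prod_(u <- s) gen u) = psi_words s.
Variables (lam : nat -> nat) (L : word nat -> A).
Hypothesis L_gen : forall w, L w = icomb (fun u => gen (map (rlet lam) u)) (eps w).

(** Expanding a Lie word by [eps] and projecting back changes nothing under [psi], by [psi_proj].
    The induction treats the words of [r] one by one, while [s] collects the associative words met
    on the way. *)
Lemma Phi_word_prod (r : mono nat) s :
  Phi ((\prod_(w <- r) L w) * (\prod_(u <- s) gen u)) =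
  kcomb (fun m => psi (map (map (rlet lam)) r ++ m)) (expand s).
Proof.
elim: r s => [|w r IH] s; first by rewrite big_nil mul1r Phi_gen.
rewrite big_cons -mulrA L_gen (lin_icomb _ _ (mullin _)) (lin_icomb _ _ Phi_linear).
transitivity (icomb (fun u => kcomb (fun v => kcomb (fun m =>
    psi (v :: map (map (rlet lam)) r ++ m)) (expand s)) (lie_proj k (map (rlet lam) u))) (eps w)).
  apply: eq_icomb => u /=; set u' := map _ u.
  have -> : gen u' * ((\prod_(w <- r) L w) * (\prod_(u <- s) gen u)) =
            (\prod_(w <- r) L w) * (\prod_(v <- u' :: s) gen v).
    by rewrite big_cons mulrCA.
  rewrite IH kcomb_expand.
  apply: eq_kcomb => v; apply: eq_kcomb => m; apply: psi_perm.
  by rewrite perm_sym -cat1s perm_catCA.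
under eq_icomb do rewrite kcomb_exchange.
rewrite icomb_kcomb_exchange; apply: eq_kcomb => m /=.
rewrite -psi_proj eps_map (icomb_map1 _ (map (rlet lam))).
by apply: eq_icomb.
Qed.
End Functional.

Section PhiFunctional.
Variables (k : fieldType) (V : gdAlgType k) (tb : trie).
Hypothesis tb_rel : forall (y : nat -> V) p, isnil (nf_comb tb p) -> peval y p = 0.
Hypothesis tb_check : check tb.
Variable x : nat -> V.

Definition phi_at (m : mono nat) : V := phi_val (mapl x m).

Lemma phi_at_undef m : ~~ admissible (shape m) -> phi_at m = 0.
Proof. by move=> dm; apply: phi_val_undef; rewrite shape_mapl. Qed.

Lemma phi_at_swap s a b r : phi_at (s ++ a :: b :: r) = phi_at (s ++ b :: a :: r).
Proof. by rewrite /phi_at /mapl !map_cat; apply: phi_val_swap tb_rel tb_check _ _ _ _. Qed.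

Lemma phi_at_rel (w : word nat) m (r : seq (int * seq nat)) : r \in lie_rels (size w) ->
  icomb (fun p => phi_at ([seq nth (0, 0)%N w i | i <- p] :: m)) r = 0.
Proof.
move=> rw; pose wV := map (fun y => (x y.1, y.2)) w.
have rwV : r \in lie_rels (size wV) by rewrite size_map.
rewrite -[RHS](phi_val_lie tb_rel tb_check (mapl x m) rwV).
apply: eq_in_icomb => cp cpr.
suff -> : [seq nth (0, 0%N) wV i | i <- cp.2] =
  map (fun y => (x y.1, y.2)) [seq nth (0, 0)%N w i | i <- cp.2] by [].
rewrite -map_comp; apply/eq_in_map => i.
rewrite (perm_mem (lie_rels_perm rw cpr)) mem_iota /= => iw.
by rewrite /wV (nth_map (0, 0)%N).
Qed.
End PhiFunctional.

(** * The two test algebras and the conclusion *)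

Lemma special_derived (k : fieldType) (P : diffPoissonType k) : special (derivedGD P).
Proof. by exists P, id; split=> //; split. Qed.

Section LieAlgebra.
Variables (k : fieldType) (V : gdAlgType k).

Let zero2 (_ _ : V) : V := 0.
Let zero1 (_ : V) : V := 0.

Fact zero2_bilinear : bilinear_op zero2.
Proof. by split=> [z | z] c u v /=; rewrite /zero2 scaler0 addr0. Qed.
Fact zero2A : associative zero2. Proof. by []. Qed.
Fact zero2C : commutative zero2. Proof. by []. Qed.
Fact zero1_linear : linear zero1.
Proof. by move=> c u v; rewrite /zero1 scaler0 addr0. Qed.
Fact zero_leibniz (x y z : V) :
  brk x (zero2 y z) = zero2 y (brk x z) + zero2 z (brk x y).
Proof. by rewrite /zero2 (lin0 (gd_brk_linr _)) addr0. Qed.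
Fact zero_der_mul (x y : V) : zero1 (zero2 x y) = zero2 x (zero1 y) + zero2 (zero1 x) y.
Proof. by rewrite /zero2 /zero1 addr0. Qed.
Fact zero_der_brk (x y : V) : zero1 (brk x y) = brk (zero1 x) y + brk x (zero1 y).
Proof. by rewrite /zero1 (lin0 (gd_brk_linr _)) (lin0 (gd_brk_linl _)) addr0. Qed.

Definition lie_poisson : diffPoissonType k :=
  HB.pack (GDAlgebra.sort V) (Lmodule_isDiffPoisson.Build k V
    zero2_bilinear zero2A zero2C (brk_lie (s := V)) zero_leibniz zero1_linear
    zero_der_mul zero_der_brk).

(** A circ yields 0, which every enclosing operation preserves, while brackets are those of [V]:
    this algebra sees exactly the part of an identity without circ. *)
Lemma meval_lie (x : nat -> V) t :
  @meval k (derivedGD lie_poisson) x t = if pure t then meval x t else 0.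
Proof.
elim: t => [i | s IHs t IHt | s IHs t IHt] //=.
rewrite IHs IHt.
change (brk (if pure s then meval x s else 0) (if pure t then meval x t else 0) =
        if pure s && pure t then brk (meval x s) (meval x t) else 0).
case: (pure s) => /=; last exact: (lin0 (gd_brk_linl _)).
by case: (pure t) => //; apply: (lin0 (gd_brk_linr _)).
Qed.
End LieAlgebra.

Section WordAlgebra.
Variables (k : fieldType) (char_k : (2%:R : k) != 0).
Local Notation W := (seq (nat * nat)).

Definition word_gen : W -> {malg k[{cmonom W}]} := @gen k W.
Definition word_ext := @poly_lin k W {malg k[{cmonom W}]}.

Lemma word_ind (P : {malg k[{cmonom W}]} -> Prop) :
    P 0 -> (forall c p q, P p -> P q -> P (c *: p + q)) ->
    (forall s, P (\prod_(u <- s) word_gen u)) ->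
  forall p, P p.
Proof. exact: poly_ind. Qed.

Lemma word_ext_linear h : linear (word_ext h).
Proof. exact: poly_lin_linear. Qed.

Lemma word_ext_mon h : (forall s t, perm_eq s t -> h s = h t) ->
  forall s, word_ext h (\prod_(u <- s) word_gen u) = h s.
Proof. exact: poly_lin_prod. Qed.

Definition word_poisson : diffPoissonType k :=
  free_poisson char_k word_ind word_ext_linear word_ext_mon.
End WordAlgebra.

Section Retraction.
Variables (k : fieldType) (char_k : (2%:R : k) != 0) (V : gdAlgType k) (tb : trie).
Hypothesis tb_rel : forall (y : nat -> V) p, isnil (nf_comb tb p) -> peval y p = 0.
Hypothesis tb_check : check tb.
Variable x : nat -> V.
Local Notation W := (seq (nat * nat)).

Definition retract : {malg k[{cmonom W}]} -> V :=
  @poly_lin k W V (psi_words (phi_at x)).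

Lemma retract_linear : linear retract.
Proof. exact: poly_lin_linear. Qed.

Lemma retract_gen s : retract (\prod_(u <- s) word_gen k u) = psi_words (phi_at x) s.
Proof.
apply: poly_lin_prod; exact: (psi_words_perm (phi_at_swap tb_rel tb_check x)).
Qed.

(** The monomial is made multilinear by [renumber] and expanded into products of Lie words, on which
    [retract] takes the values of [phi_at]; these add up by [phi_val_norm]. *)
Lemma retract_meval t : (mdegree t <= 5)%N ->
  retract (@meval k (derivedGD (word_poisson char_k))
             (fun i => word_gen k [:: (i, 0%N)]) t) =
  if pure t then 0 else meval x t.
Proof.
move=> le; set X := (fun i => _); set lam := nth 0%N (leaves t).
have tE : t = trename lam (renumber 0 t).
  by have := renumberK t [::] [::]; rewrite /= cats0 => ->.
have mE (U : gdAlgType k) (y : nat -> U) : meval y t = meval (y \o lam) (renumber 0 t).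
  by rewrite {1}tE meval_trename.
rewrite mE [in RHS]mE -(phi_val_norm tb_rel tb_check (x \o lam) le).
have -> : @meval k (derivedGD (word_poisson char_k)) (X \o lam) (renumber 0 t) = icomb
    (lmon (@word_gen k) (@word_ext k) lam) (norm (renumber 0 t)).
  by rewrite -(meval_norm char_k (@word_ind k) (@word_ext_linear k) (@word_ext_mon k)).
rewrite (lin_icomb _ _ retract_linear); apply: eq_icomb => m /=.
have := Phi_word_prod char_k (phi_at_undef x) (phi_at_swap tb_rel tb_check x)
  (phi_at_rel tb_rel tb_check x) retract_linear retract_gen
  (lword_gen (@word_ind k) (@word_ext_linear k) (@word_ext_mon k) lam) m [::].
rewrite big_nil mulr1 => ->; rewrite kcomb1 scale1r cats0.
rewrite /phi_at; congr phi_val; rewrite /mapl -map_comp; apply: eq_map => w /=.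
by rewrite -map_comp.
Qed.
End Retraction.

(** Sorted by size, so that the bases of proper subsets are available when a set is treated. *)
Definition subsets5 : seq (seq nat) := flatten [seq subsets_of_size n | n <- iota 2 4].

(** The existential, closed opaquely, keeps the concrete table out of later conversions. *)
Lemma exists_checked_table : exists l, check (table_of l).
Proof. by exists subsets5; vm_compute. Qed.

Theorem mainTheorem4 (k : fieldType) (char_k : (2%:R : k) != 0)
    (f : {malg k[gdmonom]}) :
  (gddegree f <= 5)%N ->
  (forall V : gdAlgType k, special V -> holds_on V f) ->
  forall V : gdAlgType k,
    (forall a b c d : V,
      ({< c, a \circ d >} \circ b + ({< a, c >} \circ d) \circ b =
       {< c, (a \circ b) \circ d >} - {< c, a \circ b >} \circ d)%GD) ->
    (forall a b c d : V,
      ((({< a, b >} \circ c) \circ d) *+ 2 =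
       {< b \circ c, a \circ d >} - {< a \circ c, b \circ d >}
       + ({< a, b \circ c >} - {< b, a \circ c >}) \circ d
       + ({< a, b \circ d >} - {< b, a \circ d >}) \circ c)%GD) ->
    holds_on V f.
Proof.
move=> deg_f hf V V_id1 V_id2 x.
have [l tb_check] := exists_checked_table.
have tb_ok := table_of_ok char_k V_id1 V_id2 l.
have tb_rel (y : nat -> V) p : isnil (nf_comb (table_of l) p) -> peval y p = 0.
  exact: (isnil_nf_comb y tb_ok).
have deg t : t \in msupp f -> (mdegree t <= 5)%N.
  move=> tf; apply: leq_trans deg_f.
  by rewrite /gddegree (big_rem t) //= leq_maxl.
have fP := hf _ (special_derived (word_poisson char_k))
  (fun i => word_gen k [:: (i, 0%N)]).
have fL := hf _ (special_derived (lie_poisson V)) x.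
(* Retracting the identity [fP] leaves the monomials containing a circ; [fL] supplies the remaining
   ones. *)
have := congr1 (retract x) fP; rewrite (lin0 (retract_linear x)) /gdeval.
rewrite (lin_sum (retract_linear x)) => fR.
have : \sum_(t <- msupp f) f@_t *: (if pure t then 0 else meval x t) = 0.
  rewrite -[RHS]fR !big_seq; apply: eq_bigr => t /deg le.
  by rewrite (linZ (retract_linear x)) (retract_meval char_k tb_rel tb_check).
have : \sum_(t <- msupp f) f@_t *: (if pure t then meval x t else 0) = 0.
  under eq_bigr do rewrite -meval_lie.
  exact: fL.
move=> pL pC; rewrite -[RHS](addr0 0) -[X in _ = X + _]pL -[X in _ = _ + X]pC.
rewrite -big_split; apply: eq_bigr => t _ /=.
by case: (pure t); rewrite scaler0 ?addr0 ?add0r.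
Qed.
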